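(* Let $a>0$, let $\mathcal{L}$ be a linear configuration and let $\mathcal{A}$ be a family of compact abelian groups such that $\mathcal{L}$ has true complexity at most $1$ in $\mathcal{A}$. Then the map $f\mapsto t(\mathcal{L},f)$ is continuous with respect to the metric $d$ on the set of (isomorphism classes of) measurable functions $f\in L^\infty(A)$ with $A\in\mathcal{A}$ and $|f|\le a$.
   Context: All compact abelian groups are second countable with normalized Haar measure. Metric $\hat d$: for a group $G$, $l^2(G)$ is the set of $f:G\to\mathbb{C}$ with $\sum_g|f(g)|^2<\infty$; ${\rm supp}_\epsilon(f)=\{g:|f(g)|>\epsilon\}$. A partial isomorphism of weight $n$ between groups $G_1,G_2$ is a bijection $\phi:S_1\to S_2$ ($S_j\subseteq G_j$) such that for all $g_1,\dots,g_n\in S_1$, $\alpha_i\in\{-1,0,1\}$: $g_1^{\alpha_1}\cdots g_n^{\alpha_n}=1$ iff $\phi(g_1)^{\alpha_1}\cdots\phi(g_n)^{\alpha_n}=1$. An $\epsilon$-isomorphism between $f_1\in l^2(G_1)$, $f_2\in l^2(G_2)$ is a partial isomorphism $\phi:S_1\to S_2$ of weight $\lceil1/\epsilon\rceil$ with ${\rm supp}_\epsilon(f_j)\subseteq S_j$ and $|f_1(g)-f_2(\phi(g))|\le\epsilon$ for $g\in S_1$; $\hat d(f_1,f_2)$ is the infimum of such $\epsilon$. For $f_j\in L^2(A_j)$ on compact abelian groups, $d(f_1,f_2)=\hat d(\hat f_1,\hat f_2)$, where $\hat f_j$ is the Fourier transform on the discrete dual group $\hat A_j$. Two functions $f_1\in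 L^2(A_1),f_2\in L^2(A_2)$ are isomorphic if there are $f_3\in L^2(A_3)$ and continuous epimorphisms $\alpha_j:A_j\to A_3$ with $f_3\circ\alpha_j=f_j$ a.e.; $d$ is a metric on isomorphism classes. Linear configurations and densities: a linear form is $L=\sum_i\lambda_ix_i$ with $\lambda_i\in\mathbb{Z}$; a linear configuration is a finite system $\mathcal{L}=\{L_1,\dots,L_k\}$ of forms in $x_1,\dots,x_n$; $t(\mathcal{L},(f_i)_i)=\mathbb{E}_{x_1,\dots,x_n\in A}\prod_{i}f_i(L_i(x_1,\dots,x_n))$ and $t(\mathcal{L},f)$ is the case $f_i=f$. $\|f\|_{U_2}=\big(\mathbb{E}_{x,a,b}f(x)\overline{f(x+a)}\,\overline{f(x+b)}f(x+a+b)\big)^{1/4}$. $\mathcal{L}$ has true complexity at most $1$ in $\mathcal{A}$ if for every $\epsilon>0$ there is $\delta>0$ such that for every $A\in\mathcal{A}$ and measurable $f_1,\dots,f_k$ on $A$ with $|f_i|\le1$ and $\|f_j\|_{U_2}\le\delta$ for some $j$, $|t(\mathcal{L},(f_i)_i)|\le\epsilon$. *)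

(* Defs.v *)
From HB Require Import structures.
From mathcomp Require Import all_boot all_order all_algebra.
From mathcomp Require Import all_classical all_reals all_analysis.
From mathcomp Require Import complex.

Set Implicit Arguments.
Unset Strict Implicit.
Unset Printing Implicit Defensive.

Import Order.TTheory GRing.Theory Num.Theory.
Import numFieldNormedType.Exports.
Import ComplexField.Normc.

Local Open Scope classical_set_scope.
Local Open Scope ring_scope.
Local Open Scope complex_scope.

Section power_probability.
Context d (T : measurableType d) (R : realType).

Definition tuple_cons n (x : T * n.-tuple T) : n.+1.-tuple T :=
  [tuple of x.1 :: x.2].

Lemma measurable_tuple_cons n : measurable_fun setT (@tuple_cons n).
Proof.
by apply: measurable_cons; [exact: measurable_fst | exact: measurable_snd].
Qed.

HB.instance Definition _ n :=
  isMeasurableFun.Build _ _ _ _ (@tuple_cons n) (@measurable_tuple_cons n).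

(* The n-fold product measure, on the library's product sigma-algebra of
   n.-tuple T. *)
Fixpoint power_probability (P : probability T R) n :
    probability (n.-tuple T) R :=
  match n with
  | 0 => dirac ([tuple] : 0.-tuple T)
  | m.+1 => distribution (P \x power_probability P m)%E (@tuple_cons m)
  end.

(* R[i] carries no measurable structure in the library: measurability and
   integration of complex functions are componentwise. *)
Definition cmeasurable (f : T -> R[i]) :=
  measurable_fun setT (fun x => complex.Re (f x)) /\
  measurable_fun setT (fun x => complex.Im (f x)).

Definition cexpectation (P : probability T R) (f : T -> R[i]) : R[i] :=
  (\int[P]_x complex.Re (f x)) +i* (\int[P]_x complex.Im (f x)).

End power_probability.

Definition borel (A : topologicalZmodType) :=
  @g_sigma_algebraType (GRing.Zmodule.sort A) (@open A).

(* The library has no Haar measure, so it is bundled with the group; it is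
   determined by the last two fields. *)
Record compactAbelianGroup (R : realType) := CompactAbelianGroup {
  carrier :> topologicalZmodType;
  cag_hausdorff : hausdorff_space carrier;
  cag_compact : compact [set: carrier];
  cag_second_countable : @second_countable carrier;
  haar : probability (borel carrier) R;
  haar_invariant : forall (a : carrier) (U : set (borel carrier)),
    measurable U -> haar ((fun x : carrier => a + x) @^-1` U) = haar U
}.

Section dual.
Context (R : realType) (A : compactAbelianGroup R).

(* R[i]^o is R[i] with the topology of its modulus. *)
Record dual := Character {
  char_fun :> A -> R[i];
  char_add : forall x y, char_fun (x + y) = char_fun x * char_fun y;
  char_norm : forall x, `|char_fun x| = 1;
  char_continuous : continuous (char_fun : A -> R[i]^o)
}.

Lemma dual_ext (chi psi : dual) : chi =1 psi -> chi = psi.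
Proof.
case: chi => f fD fN fC; case: psi => g gD gN gC /= /funext fg.
by case: _ / fg gD gN gC => *; congr Character; exact: Prop_irrelevance.
Qed.

Lemma char_neq0 (chi : dual) x : chi x != 0.
Proof. by rewrite -normr_gt0 char_norm ltr01. Qed.

Fact dual_one_subproof :
  [/\ forall x y : A, (1 : R[i]) = 1 * 1, forall x : A, `|1 : R[i]| = 1
    & continuous ((fun=> 1) : A -> R[i]^o)].
Proof. by split=> [_ _|_|x]; rewrite ?mulr1 ?normr1//; exact: cst_continuous. Qed.

Definition dual_one : dual :=
  let: And3 D N C := dual_one_subproof in @Character (fun=> 1) D N C.

Fact dual_mul_subproof (chi psi : dual) :
  [/\ forall x y, chi (x + y) * psi (x + y) = chi x * psi x * (chi y * psi y),
      forall x, `|chi x * psi x| = 1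
    & continuous ((fun x => chi x * psi x) : A -> R[i]^o)].
Proof.
split=> [x y|x|x]; first by rewrite !char_add mulrACA.
- by rewrite normrM !char_norm mulr1.
- exact: (@cvgM _ _ _ _ (chi : A -> R[i]^o) (psi : A -> R[i]^o) _ _
    (@char_continuous chi x) (@char_continuous psi x)).
Qed.

Definition dual_mul (chi psi : dual) : dual :=
  let: And3 D N C := dual_mul_subproof chi psi in
  @Character (fun x => chi x * psi x) D N C.

Fact dual_inv_subproof (chi : dual) :
  [/\ forall x y, (chi (x + y))^-1 = (chi x)^-1 * (chi y)^-1,
      forall x, `|(chi x)^-1| = 1
    & continuous ((fun x => (chi x)^-1) : A -> R[i]^o)].
Proof.
split=> [x y|x|x]; first by rewrite char_add invfM.
- by rewrite normfV char_norm invr1.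
- exact: (@cvgV _ _ _ _ (chi : A -> R[i]^o) _
    (char_neq0 chi x) (@char_continuous chi x)).
Qed.

Definition dual_inv (chi : dual) : dual :=
  let: And3 D N C := dual_inv_subproof chi in
  @Character (fun x => (chi x)^-1) D N C.

Lemma dual_oneE x : dual_one x = 1.
Proof. by rewrite /dual_one; case: dual_one_subproof. Qed.

Lemma dual_mulE chi psi x : dual_mul chi psi x = chi x * psi x.
Proof. by rewrite /dual_mul; case: dual_mul_subproof. Qed.

Lemma dual_invE chi x : dual_inv chi x = (chi x)^-1.
Proof. by rewrite /dual_inv; case: dual_inv_subproof. Qed.

HB.instance Definition _ := gen_eqMixin dual.
HB.instance Definition _ := gen_choiceMixin dual.

Let dual_mulA : associative dual_mul.
Proof. by move=> f g h; apply: dual_ext => x; rewrite !dual_mulE mulrA. Qed.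
Let dual_mul1 : left_id dual_one dual_mul.
Proof. by move=> f; apply: dual_ext => x; rewrite dual_mulE dual_oneE mul1r. Qed.
Let dual_mulr1 : right_id dual_one dual_mul.
Proof. by move=> f; apply: dual_ext => x; rewrite dual_mulE dual_oneE mulr1. Qed.
Let dual_mulV : left_inverse dual_one dual_inv dual_mul.
Proof.
move=> f; apply: dual_ext => x.
by rewrite dual_mulE dual_invE dual_oneE mulVf ?char_neq0.
Qed.
Let dual_mulrV : right_inverse dual_one dual_inv dual_mul.
Proof.
move=> f; apply: dual_ext => x.
by rewrite dual_mulE dual_invE dual_oneE mulfV ?char_neq0.
Qed.

HB.instance Definition _ :=
  isGroup.Build dual dual_mulA dual_mul1 dual_mulr1 dual_mulV dual_mulrV.

Definition fourier (f : A -> R[i]) (chi : dual) : R[i] :=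
  cexpectation (haar A) (fun x => f x * (chi x)^*).

End dual.

Section partial_isomorphisms.

Definition int_expg (G : groupType) (g : G) (z : int) : G :=
  match z with Posz n => (g ^+ n)%g | Negz n => (g ^- n.+1)%g end.

(* The bijection S1 -> S2 is encoded as a total function, of which only the
   values on S1 matter. *)
Definition partial_isomorphism (G1 G2 : groupType) (n : nat)
    (S1 : set G1) (S2 : set G2) (phi : G1 -> G2) :=
  set_bij S1 S2 phi /\
  forall (g : 'I_n -> G1) (alpha : 'I_n -> int),
    (forall i, S1 (g i)) -> (forall i, alpha i \in [:: -1; 0; 1]) ->
    (\prod_(i < n) int_expg (g i) (alpha i) = 1)%g <->
    (\prod_(i < n) int_expg (phi (g i)) (alpha i) = 1)%g.

Context (R : realType).

Definition supp (G : groupType) (eps : R) (f : G -> R[i]) : set G :=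
  [set g | eps < normc (f g)].

Definition eps_isomorphism (G1 G2 : groupType) (eps : R)
    (f1 : G1 -> R[i]) (f2 : G2 -> R[i])
    (S1 : set G1) (S2 : set G2) (phi : G1 -> G2) :=
  [/\ partial_isomorphism `|Num.ceil eps^-1|%N S1 S2 phi,
      supp eps f1 `<=` S1, supp eps f2 `<=` S2 &
      forall g, S1 g -> normc (f1 g - f2 (phi g)) <= eps].

Definition dhat (G1 G2 : groupType) (f1 : G1 -> R[i]) (f2 : G2 -> R[i]) : R :=
  inf [set eps | 0 < eps /\ exists S1 S2 phi,
                   eps_isomorphism eps f1 f2 S1 S2 phi].

End partial_isomorphisms.

Section functions_on_groups.
Context (R : realType).
Implicit Types A : compactAbelianGroup R.

Definition fdist A1 A2 (f1 : A1 -> R[i]) (f2 : A2 -> R[i]) : R :=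
  dhat (fourier f1) (fourier f2).

Definition L2 A (f : A -> R[i]) :=
  cmeasurable (f : borel A -> R[i]) /\
  (\int[haar A]_x (normc (f x) ^+ 2)%:E < +oo)%E.

Definition Linfty_ball A (a : R) (f : A -> R[i]) :=
  cmeasurable (f : borel A -> R[i]) /\ {ae haar A, forall x, normc (f x) <= a}.

Definition epimorphism A1 A2 (alpha : {additive A1 -> A2}) :=
  continuous alpha /\ set_surj setT setT alpha.

Definition isomorphic A1 A2 (f1 : A1 -> R[i]) (f2 : A2 -> R[i]) :=
  exists (A3 : compactAbelianGroup R) (f3 : A3 -> R[i])
      (alpha1 : {additive A1 -> A3}) (alpha2 : {additive A2 -> A3}),
    [/\ L2 f3, epimorphism alpha1, epimorphism alpha2,
        {ae haar A1, forall x, f3 (alpha1 x) = f1 x} &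
        {ae haar A2, forall x, f3 (alpha2 x) = f2 x}].

(* A configuration of k linear forms in n variables is given by the matrix of
   its coefficients, with one row for each form. *)
Definition linear_form A k n (L : 'M[int]_(k, n)) (i : 'I_k)
    (x : n.-tuple (borel A)) : A :=
  \sum_(j < n) (tnth x j : A) *~ L i j.

Definition densities A k n (L : 'M[int]_(k, n)) (f : 'I_k -> A -> R[i]) : R[i] :=
  cexpectation (power_probability (haar A) n)
    (fun x => \prod_(i < k) f i (linear_form L i x)).

Definition density A k n (L : 'M[int]_(k, n)) (f : A -> R[i]) : R[i] :=
  densities L (fun=> f).

(* The expectation is a nonnegative real number. *)
Definition U2norm A (f : A -> R[i]) : R :=
  complex.Re (cexpectation (haar A \x (haar A \x haar A))%E
    (fun t : borel A * (borel A * borel A) =>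
       let: (x, (a, b)) := t : A * (A * A) in
       f x * (f (x + a))^* * (f (x + b))^* * f (x + a + b))) `^ 4^-1.

Definition true_complexity_le1 k n (L : 'M[int]_(k, n))
    (F : compactAbelianGroup R -> Prop) :=
  forall eps : R, 0 < eps -> exists2 delta : R, 0 < delta &
    forall (A : compactAbelianGroup R) (f : 'I_k -> A -> R[i]),
      F A ->
      (forall i, cmeasurable (f i : borel A -> R[i])) ->
      (forall i x, normc (f i x) <= 1) ->
      (exists j, U2norm (f j) <= delta) ->
      normc (densities L f) <= eps.

End functions_on_groups.

(* Main.v *)
(* For isomorphic functions the hypothesis of true complexity forces every
   linear form to pull null sets back to null sets, so both densities equal
   that of the common factor.

   For continuity, true complexity bounds the variation of the density by the
   U2 norm, and the U2 norm of a bounded function is controlled by its largest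
   Fourier coefficient.  The latter needs characters: the top eigenspace of
   convolution by h * h~ is cut down to an idempotent of minimal trace, which
   is a multiple of a character.  So f may be replaced by its convolution with
   the Fejer kernel of a Folner set B in the group generated by the large
   spectrum of f, a trigonometric polynomial that stays bounded by a.  A
   partial isomorphism of large weight carries B to a Folner set adapted to g,
   and the densities of the two trigonometric polynomials are finite sums over
   the same additive relations with nearly equal coefficients. *)
Require Import Defs.
From HB Require Import structures.
From mathcomp Require Import all_boot all_order all_algebra.
From mathcomp Require Import all_classical all_reals all_analysis.
From mathcomp Require Import complex measurable_realfun zify ring lra.

Set Implicit Arguments.
Unset Strict Implicit.
Unset Printing Implicit Defensive.

Import Order.TTheory GRing.Theory Num.Theory.
Import numFieldNormedType.Exports.
Import ComplexField.Normc.

Local Open Scope classical_set_scope.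
Local Open Scope ring_scope.

Local Notation "x %:C" := (real_complex _ x) : ring_scope.

(** * Integration of bounded complex functions *)

Section complex_facts.
Variable R : rcfType.
Implicit Types z w : R[i].

Lemma normC_normc z : `|z| = (normc z)%:C.
Proof. by case: z. Qed.

Lemma cReD z w : complex.Re (z + w) = complex.Re z + complex.Re w.
Proof. by case: z => ? ?; case: w. Qed.
Lemma cImD z w : complex.Im (z + w) = complex.Im z + complex.Im w.
Proof. by case: z => ? ?; case: w. Qed.
Lemma cReM z w : complex.Re (z * w) =
  complex.Re z * complex.Re w - complex.Im z * complex.Im w.
Proof. by case: z => ? ?; case: w. Qed.
Lemma cImM z w : complex.Im (z * w) =
  complex.Re z * complex.Im w + complex.Im z * complex.Re w.
Proof. by case: z => ? ?; case: w. Qed.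
Lemma cReJ z : complex.Re z^* = complex.Re z.
Proof. by case: z. Qed.
Lemma cImJ z : complex.Im z^* = - complex.Im z.
Proof. by case: z. Qed.
Lemma complex_ext z w : complex.Re z = complex.Re w ->
  complex.Im z = complex.Im w -> z = w.
Proof. by case: z => ? ?; case: w => ? ? /= -> ->. Qed.

Lemma cReB z w : complex.Re (z - w) = complex.Re z - complex.Re w.
Proof. by case: z => ? ?; case: w. Qed.
Lemma cImB z w : complex.Im (z - w) = complex.Im z - complex.Im w.
Proof. by case: z => ? ?; case: w. Qed.

Lemma ler_Re_norm z : (`|complex.Re z|)%:C <= `|z|.
Proof. exact: normc_ge_Re. Qed.

Lemma ler_Im_norm z : (`|complex.Im z|)%:C <= `|z|.
Proof.
have -> : `|z| = `|z * 'i%C|.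
  rewrite normrM (_ : `|'i%C| = 1 :> R[i]) ?mulr1//.
  by rewrite normc_def/= expr0n expr1n add0r sqrtr1.
by have := normc_ge_Re (z * 'i%C); rewrite ReiNIm normrN.
Qed.

Lemma conjcD z w : (z + w)^* = z^* + w^*.
Proof. exact: rmorphD. Qed.
Lemma conjcM z w : (z * w)^* = z^* * w^*.
Proof. exact: rmorphM. Qed.
Lemma conjcN z : (- z)^* = - z^*.
Proof. exact: rmorphN. Qed.

Lemma sqr_normC_ge0 z : 0 <= z * z^*.
Proof. exact: mul_conjC_ge0. Qed.

End complex_facts.

Section real_complex_morphism.
Variable R : rcfType.
Implicit Types x y : R.

Lemma rcD x y : (x + y)%:C = x%:C + y%:C :> R[i]. Proof. exact: rmorphD. Qed.
Lemma rcN x : (- x)%:C = - x%:C :> R[i]. Proof. exact: rmorphN. Qed.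
Lemma rcB x y : (x - y)%:C = x%:C - y%:C :> R[i]. Proof. exact: rmorphB. Qed.
Lemma rcM x y : (x * y)%:C = x%:C * y%:C :> R[i]. Proof. exact: rmorphM. Qed.
Lemma rcX x n : (x ^+ n)%:C = x%:C ^+ n :> R[i]. Proof. exact: rmorphXn. Qed.
Lemma rcV x : (x^-1)%:C = (x%:C)^-1 :> R[i]. Proof. exact: fmorphV. Qed.
Lemma rc_nat n : (n%:R : R)%:C = n%:R :> R[i]. Proof. exact: rmorph_nat. Qed.
Lemma rcJ x : (x%:C)^* = x%:C :> R[i].
Proof. by rewrite conj_Creal// complex_real. Qed.
Lemma rc_norm x : `|x%:C| = `|x|%:C :> R[i].
Proof. by rewrite normC_normc /= expr0n addr0 sqrtr_sqr. Qed.
Lemma rc_ge0 (z : R[i]) : 0 <= z -> (complex.Re z)%:C = z.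
Proof. by move=> z0; rewrite RRe_real// ger0_real. Qed.

End real_complex_morphism.

Section bounded_measurable.
Context d (T : measurableType d) (R : realType).
Implicit Types f g : T -> R[i].

Definition bm f := cmeasurable f /\ exists M : R[i], forall x, `|f x| <= M.

Lemma bm_ext f g : f =1 g -> bm f -> bm g.
Proof. by move=> /funext ->. Qed.

Lemma bm_cst (c : R[i]) : bm (fun=> c).
Proof.
by split; [split; exact: measurable_cst | exists `|c|].
Qed.

Lemma bmD f g : bm f -> bm g -> bm (fun x => f x + g x).
Proof.
move=> [[f1 f2] [M fM]] [[g1 g2] [N gN]]; split; last first.
  by exists (M + N) => x; rewrite (le_trans (ler_normD _ _))// lerD.
by split; [under eq_fun do rewrite cReD|under eq_fun do rewrite cImD];
  exact: measurable_funD.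
Qed.

Lemma cmeasurableM f g : cmeasurable f -> cmeasurable g ->
  cmeasurable (fun x => f x * g x).
Proof.
move=> [f1 f2] [g1 g2]; split; [under eq_fun do rewrite cReM|under eq_fun do rewrite cImM].
  by apply: measurable_funB; exact: measurable_funM.
by apply: measurable_funD; exact: measurable_funM.
Qed.

Lemma bmM f g : bm f -> bm g -> bm (fun x => f x * g x).
Proof.
move=> [mf [M fM]] [mg [N gN]]; split; first exact: cmeasurableM.
by exists (M * N) => x; rewrite normrM ler_pM.
Qed.

Lemma cmeasurable_prod I (r : seq I) (p : pred I) (F : I -> T -> R[i]) :
  (forall i, cmeasurable (F i)) ->
  cmeasurable (fun x => \prod_(i <- r | p i) F i x).
Proof.
move=> bF; elim: r => [|i r IH].
  under eq_fun do rewrite big_nil; by have [] := bm_cst 1.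
under eq_fun do rewrite big_cons.
by case: (p i) => //; exact: cmeasurableM.
Qed.

Lemma bmJ f : bm f -> bm (fun x => (f x)^*).
Proof.
move=> [[f1 f2] [M fM]]; split; last by exists M => x; rewrite norm_conjC.
split; [under eq_fun do rewrite cReJ|under eq_fun do rewrite cImJ] => //.
exact: measurableT_comp.
Qed.

Lemma bmZ c f : bm f -> bm (fun x => c * f x).
Proof. by move=> bf; apply: bmM => //; exact: bm_cst. Qed.

Lemma bmN f : bm f -> bm (fun x => - f x).
Proof.
by move=> /(bmZ (-1)); apply: bm_ext => x; rewrite mulN1r.
Qed.

Lemma bmB f g : bm f -> bm g -> bm (fun x => f x - g x).
Proof. by move=> bf /bmN; exact: bmD. Qed.

Lemma bm_sum I (r : seq I) (p : pred I) (F : I -> T -> R[i]) :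
  (forall i, bm (F i)) -> bm (fun x => \sum_(i <- r | p i) F i x).
Proof.
move=> bF; elim: r => [|i r IH].
  by apply: bm_ext (bm_cst 0) => x; rewrite big_nil.
case pi : (p i); last by apply: bm_ext IH => x; rewrite big_cons pi.
by apply: bm_ext (bmD (bF i) IH) => x; rewrite big_cons pi.
Qed.

Lemma bm_prod I (r : seq I) (p : pred I) (F : I -> T -> R[i]) :
  (forall i, bm (F i)) -> bm (fun x => \prod_(i <- r | p i) F i x).
Proof.
move=> bF; elim: r => [|i r IH].
  by apply: bm_ext (bm_cst 1) => x; rewrite big_nil.
case pi : (p i); last by apply: bm_ext IH => x; rewrite big_cons pi.
by apply: bm_ext (bmM (bF i) IH) => x; rewrite big_cons pi.
Qed.

Lemma bm_indic (U : set T) : measurable U -> bm (fun x => (\1_U x : R)%:C).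
Proof.
move=> mU; split; last first.
  exists 1 => x; rewrite normc_def/= expr0n addr0 sqrtr_sqr lecR.
  by rewrite /indic; case: (_ \in _); rewrite ?normr1// normr0.
by split => /=; [exact: measurable_indic|exact: measurable_cst].
Qed.

End bounded_measurable.
Arguments bm_cst {d T R} c.

Lemma bm_comp d d' (T : measurableType d) (T' : measurableType d')
  (R : realType) (f : T' -> R[i]) (phi : T -> T') :
  measurable_fun setT phi -> bm f -> bm (f \o phi).
Proof.
move=> mphi [[f1 f2] [M fM]]; split; last by exists M => x /=.
by split; [exact: (measurableT_comp f1)|exact: (measurableT_comp f2)].
Qed.

Section expectation.
Context d (T : measurableType d) (R : realType) (P : probability T R).
Implicit Types f g : T -> R[i].
Local Notation E := (cexpectation P).

Lemma bounded_integrable (h : T -> R) (M : R) : measurable_fun setT h ->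
  (forall x, `|h x| <= M) -> P.-integrable setT (EFin \o h).
Proof.
move=> mh hM; apply: measurable_bounded_integrable => //.
  by rewrite ltey_eq fin_num_measure.
exists `|M|; split; first exact: normr_real.
by move=> N MN x _ /=; rewrite (le_trans (hM x))// (le_trans (ler_norm _))// ltW.
Qed.

Lemma bm_integrable f : bm f ->
  P.-integrable setT (EFin \o (fun x => complex.Re (f x))) /\
  P.-integrable setT (EFin \o (fun x => complex.Im (f x))).
Proof.
move=> [[f1 f2] [M fM]].
have M0 : 0 <= M by rewrite (le_trans _ (fM point)).
have MR : M = (complex.Re M)%:C by rewrite RRe_real// ger0_real.
split; apply: (@bounded_integrable _ (complex.Re M)) => // x;
  rewrite -lecR -MR (le_trans _ (fM x))//.
  exact: ler_Re_norm.
exact: ler_Im_norm.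
Qed.

Lemma eq_cexp f g : f =1 g -> E f = E g.
Proof. by move=> /funext ->. Qed.

Lemma cexp_cst c : E (fun=> c) = c.
Proof.
have P1 : fine (P setT) = 1 by rewrite [X in fine X]probability_setT.
rewrite /cexpectation !Rintegral_cst// [fine _]P1 !mulr1.
by case: c.
Qed.

Lemma cexpD f g : bm f -> bm g -> E (fun x => f x + g x) = E f + E g.
Proof.
move=> /bm_integrable[f1 f2] /bm_integrable[g1 g2].
apply: complex_ext => /=.
  by under eq_Rintegral do rewrite cReD; rewrite RintegralD.
by under eq_Rintegral do rewrite cImD; rewrite RintegralD.
Qed.

Lemma cexpZ c f : bm f -> E (fun x => c * f x) = c * E f.
Proof.
move=> /bm_integrable[f1 f2].
have iZ r (h : T -> R) : P.-integrable setT (EFin \o h) ->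
    P.-integrable setT (EFin \o (fun x => r * h x)).
  by move=> ih; rewrite (_ : _ \o _ = fun x => (r%:E * (EFin \o h) x)%E)//;
    exact: integrableZl.
apply: complex_ext => /=.
  under eq_Rintegral do rewrite cReM.
  rewrite RintegralB//; [|exact: iZ..].
  by rewrite cReM !RintegralZl.
under eq_Rintegral do rewrite cImM.
rewrite RintegralD//; [|exact: iZ..].
by rewrite cImM !RintegralZl.
Qed.

Lemma cexpZr c f : bm f -> E (fun x => f x * c) = E f * c.
Proof. by move=> bf; under eq_cexp do rewrite mulrC; rewrite cexpZ// mulrC. Qed.

Lemma cexpN f : bm f -> E (fun x => - f x) = - E f.
Proof.
by move=> bf; under eq_cexp do rewrite -mulN1r; rewrite cexpZ// mulN1r.
Qed.

Lemma cexpB f g : bm f -> bm g -> E (fun x => f x - g x) = E f - E g.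
Proof. by move=> bf bg; rewrite cexpD ?cexpN//; exact: bmN. Qed.

Lemma cexp_sum I (r : seq I) (p : pred I) (F : I -> T -> R[i]) :
  (forall i, bm (F i)) ->
  E (fun x => \sum_(i <- r | p i) F i x) = \sum_(i <- r | p i) E (F i).
Proof.
move=> bF; elim: r => [|i r IH].
  by rewrite big_nil; under eq_cexp do rewrite big_nil; rewrite cexp_cst.
rewrite big_cons; case pi : (p i); last first.
  by under eq_cexp do rewrite big_cons pi.
under eq_cexp do rewrite big_cons pi.
by rewrite cexpD ?IH//; exact: bm_sum.
Qed.

Lemma cexpJ f : bm f -> E (fun x => (f x)^*) = (E f)^*.
Proof.
move=> /bm_integrable[f1 f2]; apply: complex_ext => /=.
  by under eq_Rintegral do rewrite cReJ.
under eq_Rintegral do rewrite cImJ -mulN1r.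
by rewrite RintegralZl// mulN1r.
Qed.

Lemma cexp_ge0 f : (forall x, 0 <= f x) -> 0 <= E f.
Proof.
move=> f0; rewrite lecE/=; apply/andP; split.
  rewrite (_ : Rintegral _ _ _ = 0)//.
  under eq_Rintegral do rewrite ger0_Im//.
  by rewrite Rintegral_cst// mul0r.
by apply: Rintegral_ge0 => x _; move: (f0 x); rewrite lecE => /andP[].
Qed.

Lemma le_cexp f g : bm f -> bm g -> (forall x, f x <= g x) -> E f <= E g.
Proof.
move=> bf bg fg; rewrite -subr_ge0 -cexpB//; apply: cexp_ge0 => x.
by rewrite subr_ge0.
Qed.

(* [E] of a squared modulus, written with conjugates to stay in [R[i]]. *)
Definition sqn f : R[i] := E (fun x => f x * (f x)^*).

Lemma bm_sq f : bm f -> bm (fun x => f x * (f x)^*).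
Proof. by move=> bf; apply: bmM => //; exact: bmJ. Qed.

Lemma sqn_ge0 f : 0 <= sqn f.
Proof. by apply: cexp_ge0 => x; exact: sqr_normC_ge0. Qed.

Lemma cauchy_schwarz f g : bm f -> bm g ->
  `|E (fun x => f x * (g x)^*)| ^+ 2 <= sqn f * sqn g.
Proof.
move=> bf bg; set c := E _.
have bfg : bm (fun x => f x * (g x)^*) by apply: bmM => //; exact: bmJ.
have expand (s t : R[i]) : sqn (fun x => s * f x + t * g x) =
    s * s^* * sqn f + s * t^* * c + (s * t^* * c)^* + t * t^* * sqn g.
  rewrite /sqn.
  have e x : (s * f x + t * g x) * (s * f x + t * g x)^* =
      s * s^* * (f x * (f x)^*) + s * t^* * (f x * (g x)^*)
      + t * s^* * (f x * (g x)^*)^* + t * t^* * (g x * (g x)^*).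
    by rewrite !(conjcD, conjcM) ?conjCK; ring.
  rewrite (eq_cexp e).
  have b1 := bmZ (s * s^*) (bm_sq bf).
  have b2 := bmZ (s * t^*) bfg.
  have b3 := bmZ (t * s^*) (bmJ bfg).
  have b4 := bmZ (t * t^*) (bm_sq bg).
  rewrite !cexpD ?cexpZ ?cexpJ//; try by repeat apply: bmD.
  all: try exact: bmJ.
  all: try exact: bm_sq.
  by rewrite -/c !conjcM conjCK (mulrC t s^*).
have cc : c * c^* = `|c| ^+ 2 by rewrite normCK.
have key (s : R[i]) : 0 <= s -> 0 <= s ^+ 2 * sqn f - 2 * s * `|c| ^+ 2 + `|c| ^+ 2 * sqn g.
  move=> s0; have sJ : s^* = s by rewrite geC0_conj.
  have := sqn_ge0 (fun x => s * f x + (- c) * g x); rewrite expand.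
  rewrite !(conjcM, conjcN) ?conjCK !sJ -cc => h.
  by apply: le_trans h _; rewrite le_eqVlt; apply/orP; left; apply/eqP; ring.
have [g0|g0] := eqVneq (sqn g) 0.
  rewrite g0 mulr0.
  have [c0|cp] := eqVneq `|c| 0; first by rewrite c0 expr0n.
  have c2 : 0 < `|c| ^+ 2 by rewrite exprn_gt0// lt_def cp normr_ge0.
  have F1 : 0 < sqn f + 1 by rewrite ltr_wpDl ?sqn_ge0.
  have := key ((sqn f + 1)^-1 * `|c| ^+ 2).
  rewrite g0 mulr0 addr0 => /(_ (mulr_ge0 _ (ltW c2))).
  rewrite invr_ge0 (ltW F1) => /(_ isT).
  set u := (sqn f + 1)^-1; set v := `|c| ^+ 2.
  have up : 0 < u by rewrite invr_gt0.
  have uF : u * sqn f <= 1 by rewrite mulrC ler_pdivrMr// mul1r lerDl ler01.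
  rewrite (_ : _ - _ = (u * v ^+ 2) * (u * sqn f - 2)); last by ring.
  rewrite pmulr_rge0; last by rewrite mulr_gt0// exprn_gt0.
  rewrite subr_ge0 => /le_trans/(_ uF); rewrite (_ : 2 = 1 + 1)// gerDl.
  by rewrite lt_geF// ltr01.
have gp : 0 < sqn g by rewrite lt_def g0 sqn_ge0.
have [c0|cp] := eqVneq `|c| 0; first by rewrite c0 expr0n/= mulr_ge0 ?sqn_ge0.
have c2 : 0 < `|c| ^+ 2 by rewrite exprn_gt0// lt_def cp normr_ge0.
have := key (sqn g) (ltW gp).
rewrite (_ : _ + _ = sqn g * (sqn f * sqn g - `|c| ^+ 2)); last by ring.
by rewrite pmulr_rge0// subr_ge0.
Qed.

Lemma sqn_cst c : sqn (fun=> c) = c * c^*.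
Proof. exact: cexp_cst. Qed.

Lemma norm_cexp_sqn f : bm f -> `|E f| ^+ 2 <= sqn f.
Proof.
move=> bf; have := cauchy_schwarz bf (bm_cst 1).
by rewrite sqn_cst rmorph1 !mulr1; under eq_cexp do rewrite mulr1.
Qed.

Lemma sqn_le f (C : R[i]) : bm f -> (forall x, `|f x| <= C) -> sqn f <= C ^+ 2.
Proof.
move=> bf fC; rewrite -[leRHS]cexp_cst; apply: le_cexp => [||x].
- exact: bm_sq.
- exact: bm_cst.
- by rewrite -normCK lerXn2r// nnegrE// (le_trans _ (fC x)).
Qed.

Lemma norm_cexp_le f (C : R[i]) : bm f -> (forall x, `|f x| <= C) -> `|E f| <= C.
Proof.
move=> bf fC; have C0 : 0 <= C by rewrite (le_trans _ (fC point)).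
rewrite -(@ler_pXn2r _ 2)// ?nnegrE//.
exact: le_trans (norm_cexp_sqn bf) (sqn_le bf fC).
Qed.

Lemma ae_eq_cexp f g : cmeasurable f -> cmeasurable g ->
  {ae P, forall x, f x = g x} -> E f = E g.
Proof.
move=> [f1 f2] [g1 g2] fg.
congr Complex; congr fine; apply: ae_eq_integral => //.
- exact/measurable_EFinP.
- exact/measurable_EFinP.
- by apply: filterS fg => x -> _.
- exact/measurable_EFinP.
- exact/measurable_EFinP.
- by apply: filterS fg => x -> _.
Qed.

End expectation.

Section fubini_cexp.
Context d1 d2 (T1 : measurableType d1) (T2 : measurableType d2) (R : realType).
Context (P1 : probability T1 R) (P2 : probability T2 R).
Implicit Types F : T1 * T2 -> R[i].

Lemma bm_section1 F x : bm F -> bm (fun y => F (x, y)).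
Proof. by apply: (@bm_comp _ _ _ _ _ F (pair x)); exact: measurable_pair1. Qed.

Lemma bm_section2 F y : bm F -> bm (fun x => F (x, y)).
Proof. by apply: (@bm_comp _ _ _ _ _ F (pair^~ y)); exact: measurable_pair2. Qed.

Lemma bm_cexp1 F : bm F -> bm (fun x => cexpectation P2 (fun y => F (x, y))).
Proof.
move=> bF; split; last first.
  have [_ [M FM]] := bF; exists M => x; apply: norm_cexp_le => //.
  exact: bm_section1.
have [F1 F2] := bm_integrable (@dirac _ T1 point R \x P2)%E bF.
have mfine : measurable_fun setT (@fine R) by [].
split; apply: (measurableT_comp mfine).
  exact: (measurable_fubini_F F1).
exact: (measurable_fubini_F F2).
Qed.

Lemma cexp_prod1 F : bm F -> cexpectation (P1 \x P2)%E F =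
  cexpectation P1 (fun x => cexpectation P2 (fun y => F (x, y))).
Proof.
move=> bF; have [F1 F2] := bm_integrable (P1 \x P2)%E bF.
have bs x := bm_integrable P2 (bm_section1 x bF).
congr Complex; rewrite /Rintegral/=.
  rewrite -integral12_prod_meas1//; congr fine; apply: eq_integral => x _.
  by rewrite /fubini_F fineK//; apply: integrable_fin_num => //; exact: (bs x).1.
rewrite -integral12_prod_meas1//; congr fine; apply: eq_integral => x _.
by rewrite /fubini_F fineK//; apply: integrable_fin_num => //; exact: (bs x).2.
Qed.

Lemma cexp_prod2 F : bm F -> cexpectation (P1 \x P2)%E F =
  cexpectation P2 (fun y => cexpectation P1 (fun x => F (x, y))).
Proof.
move=> bF; have [F1 F2] := bm_integrable (P1 \x P2)%E bF.
have bs y := bm_integrable P1 (bm_section2 y bF).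
congr Complex; rewrite /Rintegral/=.
  rewrite -integral21_prod_meas1//; congr fine; apply: eq_integral => y _.
  by rewrite /fubini_G fineK//; apply: integrable_fin_num => //; exact: (bs y).1.
rewrite -integral21_prod_meas1//; congr fine; apply: eq_integral => y _.
by rewrite /fubini_G fineK//; apply: integrable_fin_num => //; exact: (bs y).2.
Qed.

Lemma cexp_swap F : bm F ->
  cexpectation P1 (fun x => cexpectation P2 (fun y => F (x, y))) =
  cexpectation P2 (fun y => cexpectation P1 (fun x => F (x, y))).
Proof. by move=> bF; rewrite -cexp_prod1// cexp_prod2. Qed.

End fubini_cexp.

Lemma cexp_distribution d d' (T : measurableType d) (T' : measurableType d')
    (R : realType) (P : probability T R) (X : {mfun T >-> T'})
    (f : T' -> R[i]) :
  bm f -> cexpectation (distribution P X) f = cexpectation P (f \o X).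
Proof.
move=> bf; have [f1 f2] := bm_integrable P (bm_comp (measurable_funPT X) bf).
have [[m1 m2] _] := bf.
congr Complex; rewrite /Rintegral/= integral_distribution//;
  exact/measurable_EFinP.
Qed.

Section pi_lambda.
Context d (T : measurableType d) (R : realType) (P : probability T R).

Lemma integral_pi_system_eq0 (G : set (set T)) (h : T -> \bar R) :
  @measurable _ T = <<s G >> -> setI_closed G -> G setT ->
  P.-integrable setT h ->
  (forall U, G U -> (\int[P]_(x in U) h x = 0)%E) ->
  ae_eq P setT h (cst 0%E).
Proof.
move=> GE GI GT ih hG.
have mh := measurable_int _ ih.
apply: integral_ae_eq => // S _ mS; rewrite integral0.
move: (mS); rewrite GE; move: S {mS}; apply: dynkin_induction => //.
- exact: hG.
- move=> S mS hS; have := hG _ GT.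
  rewrite -(setUv S) integral_setU//.
  + by rewrite hS add0e.
  + exact: measurableC.
  + exact: measurable_funS mh.
  + exact/disj_setPCl.
- move=> F mF tF hF; rewrite integral_bigcup//.
    by apply: eseries0 => n _ _; exact: hF.
  by apply: integrableS ih => //; exact: bigcup_measurable.
Qed.

Lemma pi_system_sqn_eq0 (G : set (set T)) (f : T -> R[i]) :
  @measurable _ T = <<s G >> -> setI_closed G -> G setT -> bm f ->
  (forall U, G U -> cexpectation P (fun x => f x * (\1_U x : R)%:C) = 0) ->
  sqn P f = 0.
Proof.
move=> GE GI GT bf fG; have [f1 f2] := bm_integrable P bf.
have mG U : G U -> measurable U by rewrite GE => GU; exact: sub_sigma_algebra.
have zero (h : T -> R) : P.-integrable setT (EFin \o h) ->
    (forall U, G U -> \int[P]_x (h x * \1_U x)%R = 0) ->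
    ae_eq P setT (EFin \o h) (cst 0%E).
  move=> ih hG; apply: (integral_pi_system_eq0 GE GI GT ih) => U GU.
  have := hG _ GU; rewrite /Rintegral.
  rewrite (_ : integral _ _ _ = \int[P]_(x in U) (EFin \o h) x)%E; last first.
    rewrite [RHS]integral_mkcond; apply: eq_integral => x _.
    by rewrite /patch /indic/=; case: ifP => _; rewrite ?mulr1 ?mulr0.
  move=> e0; rewrite -[LHS]fineK ?e0//.
  apply: integrable_fin_num; first exact: mG.
  by apply: integrableS ih => //; exact: mG.
have z1 : ae_eq P setT (EFin \o (fun x => complex.Re (f x))) (cst 0%E).
  apply: zero => // U /fG/(congr1 (@complex.Re _)) e0; rewrite -[RHS]e0.
  by apply: eq_Rintegral => x _; rewrite cReM mulr0 subr0.
have z2 : ae_eq P setT (EFin \o (fun x => complex.Im (f x))) (cst 0%E).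
  apply: zero => // U /fG/(congr1 (@complex.Im _)) e0; rewrite -[RHS]e0.
  by apply: eq_Rintegral => x _; rewrite cImM mulr0 add0r.
rewrite -[RHS](cexp_cst P); apply: ae_eq_cexp; [exact: (bm_sq bf).1|exact: (bm_cst 0).1|].
apply: filterS2 z1 z2 => x /(_ I)/= [r0] /(_ I)/= [i0].
by rewrite (_ : f x = 0) ?mul0r//; exact: complex_ext.
Qed.

End pi_lambda.

(** * Haar measure *)

Section borel_facts.
Context (R : realType).
Implicit Types A B : compactAbelianGroup R.

Lemma open_borel A (U : set A) : open U -> @measurable _ (borel A) U.
Proof. by move=> oU; exact: sub_sigma_algebra. Qed.

Lemma countable_basis A : exists e : nat -> set A,
  (forall n, open (e n)) /\
  forall (x : A) U, nbhs x U -> exists n, e n x /\ e n `<=` U.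
Proof.
have [D cD [Do Db]] := cag_second_countable A.
have [D0|[f]] := pfcard_geP cD.
  by have := Db (0 : A) setT filterT; rewrite D0 => -[U [[]]].
exists f; split.
  by move=> n; apply: Do; exact: (@funS _ _ _ _ f).
move=> x U xU; have [V [DV Vx] VU] := Db x U xU.
by have [n _ fn] := @surj _ _ _ _ f _ DV; exists n; rewrite fn.
Qed.

Lemma continuous_borel A d (T : measurableType d) (G : set (set T)) (f : A -> T) :
  @measurable _ T = <<s G >> -> (forall U, G U -> open (f @^-1` U)) ->
  measurable_fun setT (f : borel A -> T).
Proof.
move=> GE fG; apply: (measurability _ GE) => _ [U GU <-].
by rewrite setTI; apply: open_borel; exact: fG.
Qed.

Lemma continuous_measurable A B (f : A -> B) : continuous f ->
  measurable_fun setT (f : borel A -> borel B).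
Proof.
by move=> /continuousP cf; apply: (@continuous_borel _ _ (borel B) open).
Qed.

Lemma continuous_measurable_real A (f : A -> R) : continuous f ->
  measurable_fun setT (f : borel A -> R).
Proof.
move=> /continuousP cf.
apply: (continuous_borel (RGenOpens.measurableE R)) => U [a [b ->]].
by apply: cf; exact: interval_open.
Qed.

Lemma measurable_addb A :
  measurable_fun setT (fun p : borel A * borel A => (p.1 : A) + p.2 : borel A).
Proof.
have [e [eo eb]] := countable_basis A.
apply: (@measurability _ _ _ (borel A) _ _ open) => // _ [U oU <-].
rewrite setTI.
pose S i j : set (borel A * borel A) :=
  [set p | (e i p.1 /\ e j p.2) /\
    forall x y : A, e i x -> e j y -> U (x + y)].
rewrite [X in measurable X](_ : _ = \bigcup_i \bigcup_j S i j).
  apply: bigcupT_measurable => i; apply: bigcupT_measurable => j.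
  have [h|h] := pselect (forall x y : A, e i x -> e j y -> U (x + y)).
    rewrite (_ : S i j = e i `*` e j); first by apply: measurableX; exact: open_borel.
    by apply/seteqP; split => [p []|p] //=.
  rewrite (_ : S i j = set0) //.
  by apply/seteqP; split => [p []|p].
apply/seteqP; split => [[x y] /= Uxy|[x y] [i _ [j _ [[/= ei ej]]]]]; last exact.
have := @add_continuous A (x, y) U.
rewrite /= => /(_ (open_nbhs_nbhs (conj oU Uxy))) [[V W] /= [nV nW] VW].
have [i [ix iV]] := eb _ _ nV.
have [j [jy jW]] := eb _ _ nW.
exists i => //; exists j => //; split => // x' y' /iV Vx /jW Wy.
exact: (VW (x', y')).
Qed.

Lemma measurable_add2 A d (T : measurableType d) (f g : T -> A) :
  measurable_fun setT (f : T -> borel A) ->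
  measurable_fun setT (g : T -> borel A) ->
  measurable_fun setT (fun x => f x + g x : borel A).
Proof.
move=> mf mg; apply: (measurableT_comp (@measurable_addb A)
  (_ : measurable_fun setT (fun x => (f x, g x) : borel A * borel A))).
exact: measurable_fun_pair.
Qed.

Lemma measurable_oppb A : measurable_fun setT (fun x : borel A => - (x : A) : borel A).
Proof. by apply: continuous_measurable; exact: opp_continuous. Qed.

Lemma measurable_opp1 A d (T : measurableType d) (f : T -> A) :
  measurable_fun setT (f : T -> borel A) ->
  measurable_fun setT (fun x => - f x : borel A).
Proof. exact: (measurableT_comp (@measurable_oppb A)). Qed.

Lemma measurable_sum_borel A d (T : measurableType d) I (r : seq I) (F : I -> T -> A) :
  (forall i, measurable_fun setT (F i : T -> borel A)) ->
  measurable_fun setT (fun x => \sum_(i <- r) F i x : borel A).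
Proof.
move=> mF; elim: r => [|i r IH].
  by under eq_fun do rewrite big_nil; exact: measurable_cst.
by under eq_fun do rewrite big_cons; exact: measurable_add2.
Qed.

Lemma measurable_mulrz A d (T : measurableType d) (f : T -> A) z :
  measurable_fun setT (f : T -> borel A) ->
  measurable_fun setT (fun x => f x *~ z : borel A).
Proof.
move=> mf.
have mn n : measurable_fun setT (fun x => f x *+ n : borel A).
  elim: n => [|n IH]; first exact: measurable_cst.
  by under eq_fun do rewrite mulrS; exact: measurable_add2.
by case: z => n; [exact: mn|apply: measurable_opp1; exact: mn].
Qed.

Lemma continuous_cmeasurable A (f : A -> R[i]) :
  continuous (f : A -> R[i]^o) -> cmeasurable (f : borel A -> R[i]).
Proof.
move=> cf.
have aux (h : R[i] -> R) : (forall z w, h (z - w) = h z - h w) ->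
    (forall z, (`|h z|)%:C <= `|z|) ->
    measurable_fun setT (fun x : borel A => h (f x)).
  move=> hB hn; apply: continuous_measurable_real => x.
  apply/cvgrPdist_lt => e e0.
  have := cf x; move/cvgrPdist_lt => /(_ e%:C); rewrite ltcR => /(_ e0).
  apply: filterS => y; rewrite -ltcR -hB; exact: le_lt_trans.
split; apply: aux.
- by case=> ? ? [].
- exact: ler_Re_norm.
- by case=> ? ? [].
- exact: ler_Im_norm.
Qed.

Lemma bm_char A (chi : dual A) : bm (chi : borel A -> R[i]).
Proof.
split; first by apply: continuous_cmeasurable; exact: char_continuous.
by exists 1 => x; rewrite char_norm.
Qed.

End borel_facts.

Lemma cexp_measure_preserving d d' (T : measurableType d)
    (T' : measurableType d') (R : realType) (P : probability T R)
    (Q : probability T' R) (phi : T -> T') (f : T' -> R[i]) :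
  measurable_fun setT phi ->
  (forall U, measurable U -> P (phi @^-1` U) = Q U) ->
  bm f -> cexpectation P (f \o phi) = cexpectation Q f.
Proof.
move=> mphi PQ bf.
pose phi' := isMeasurableFun.Build _ _ _ _ phi mphi.
pose X : {mfun T >-> T'} := HB.pack phi phi'.
rewrite -(@cexp_distribution _ _ _ _ _ P X f)//.
by congr Complex; congr fine; apply: eq_measure_integral => U mU _; exact: PQ.
Qed.

Section haar_facts.
Context (R : realType).
Implicit Types A B : compactAbelianGroup R.

Lemma measurable_addlb A (a : A) :
  measurable_fun setT (fun x : borel A => a + (x : A) : borel A).
Proof. by apply: measurable_add2; [exact: measurable_cst|exact: measurable_id]. Qed.

Lemma measurable_addrb A (a : A) :
  measurable_fun setT (fun x : borel A => (x : A) + a : borel A).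
Proof. by apply: measurable_add2; [exact: measurable_id|exact: measurable_cst]. Qed.

Definition invariant A (mu : probability (borel A) R) :=
  forall (a : A) (U : set (borel A)), measurable U ->
    mu ((fun x : A => a + x) @^-1` U) = mu U.

Lemma invariant_cexp_shift A (mu : probability (borel A) R) (a : A)
    (f : borel A -> R[i]) : invariant mu -> bm f ->
  cexpectation mu (fun x : borel A => f (a + (x : A))) = cexpectation mu f.
Proof.
move=> imu bf.
exact: (cexp_measure_preserving (measurable_addlb a) (imu a) bf).
Qed.

Lemma invariant_cexp_unique A (mu nu : probability (borel A) R)
    (f : borel A -> R[i]) : invariant mu -> invariant nu -> bm f ->
  cexpectation mu f = cexpectation nu f.
Proof.
move=> imu inu bf.
have bF : bm (fun p : borel A * borel A => f ((p.1 : A) + p.2)).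
  exact: (bm_comp (@measurable_addb _ A) bf).
have := cexp_swap mu nu bF => /=.
under eq_cexp do rewrite (invariant_cexp_shift _ inu bf).
rewrite cexp_cst => ->.
under [RHS]eq_cexp do under eq_cexp do rewrite addrC.
under [RHS]eq_cexp do rewrite (invariant_cexp_shift _ imu bf).
by rewrite cexp_cst.
Qed.

Lemma haar_shiftl A (a : A) (f : borel A -> R[i]) : bm f ->
  cexpectation (haar A) (fun x : borel A => f (a + (x : A))) =
  cexpectation (haar A) f.
Proof. by apply: invariant_cexp_shift; exact: haar_invariant. Qed.

Lemma haar_shiftr A (a : A) (f : borel A -> R[i]) : bm f ->
  cexpectation (haar A) (fun x : borel A => f ((x : A) + a)) =
  cexpectation (haar A) f.
Proof.
by move=> bf; rewrite -[RHS](haar_shiftl a bf); apply: eq_cexp => x; rewrite addrC.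
Qed.

Lemma haar_epi A B (alpha : A -> B) (f : borel B -> R[i]) :
  {morph alpha : x y / x + y} -> continuous alpha -> set_surj setT setT alpha ->
  bm f -> cexpectation (haar A) (fun x : borel A => f (alpha x)) =
          cexpectation (haar B) f.
Proof.
move=> aD ac asurj bf.
have ma := continuous_measurable ac.
pose a' := isMeasurableFun.Build _ _ _ _ (alpha : borel A -> borel B) ma.
pose X : {mfun borel A >-> borel B} := HB.pack (alpha : borel A -> borel B) a'.
rewrite -[LHS](@cexp_distribution _ _ _ _ _ (haar A) X f)//.
apply: invariant_cexp_unique => //; last exact: haar_invariant.
move=> b U mU; have [a _ <-] := asurj b I.
rewrite /= /distribution/= /pushforward.
have mV : measurable ((alpha : borel A -> borel B) @^-1` U).
  by rewrite -[X in measurable X]setTI; exact: (continuous_measurable ac).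
rewrite -[RHS](haar_invariant a mV); congr (haar A _).
by apply/seteqP; split => x /=; rewrite aD.
Qed.

Lemma haar_opp A (f : borel A -> R[i]) : bm f ->
  cexpectation (haar A) (fun x : borel A => f (- (x : A))) =
  cexpectation (haar A) f.
Proof.
move=> bf; apply: (@haar_epi _ _ (fun x : A => - x)) => //.
- exact: opprD.
- exact: opp_continuous.
Qed.

Lemma cexp_powerS d (T : measurableType d) (P : probability T R) n
    (F : n.+1.-tuple T -> R[i]) : bm F ->
  cexpectation (power_probability P n.+1) F =
  cexpectation P (fun x =>
    cexpectation (power_probability P n) (fun t : n.-tuple T => F [tuple of x :: t])).
Proof.
move=> bF; rewrite [LHS]cexp_distribution// cexp_prod1//.
by apply: bm_comp bF; exact: measurable_tuple_cons.
Qed.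

Lemma bm_tuple_cons d (T : measurableType d) n (x : T)
    (F : n.+1.-tuple T -> R[i]) : bm F -> bm (fun t : n.-tuple T => F [tuple of x :: t]).
Proof.
move=> bF; apply: (@bm_section1 _ _ _ _ _ (F \o @tuple_cons _ T n) x).
by apply: bm_comp bF; exact: measurable_tuple_cons.
Qed.

Lemma haar_power_epi A B (alpha : A -> B) n (F : n.-tuple (borel B) -> R[i]) :
  {morph alpha : x y / x + y} -> continuous alpha -> set_surj setT setT alpha ->
  bm F ->
  cexpectation (power_probability (haar A) n)
    (fun t => F (map_tuple (alpha : borel A -> borel B) t)) =
  cexpectation (power_probability (haar B) n) F.
Proof.
move=> aD ac asurj; elim: n F => [|n IH] F bF.
  rewrite -[RHS](cexp_cst (power_probability (haar A) 0)).
  rewrite -[LHS](cexp_cst (power_probability (haar B) 0)).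
  under [RHS]eq_cexp do under eq_cexp do rewrite [X in F X]tuple0.
  under [LHS]eq_cexp do under eq_cexp do rewrite [X in F X]tuple0.
  by rewrite !cexp_cst.
have ma := continuous_measurable ac.
rewrite !cexp_powerS//; last first.
  apply: bm_comp bF; apply/measurable_fun_tnthP => i /=.
  rewrite [X in measurable_fun _ X](_ : _ =
    (alpha : borel A -> borel B) \o (tnth (T:=borel A))^~ i).
    by apply: (measurableT_comp ma); exact: measurable_tnth.
  by apply/funext => t /=; rewrite tnth_map.
rewrite -(@haar_epi A B alpha)//; last first.
  apply: (bm_cexp1 _ (_ : bm (F \o @tuple_cons _ _ n))).
  by apply: bm_comp bF; exact: measurable_tuple_cons.
apply: eq_cexp => x; rewrite -IH; last exact: bm_tuple_cons.
by apply: eq_cexp => t; congr F; apply: val_inj.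
Qed.

Lemma cexp_power_prod A n (f : 'I_n -> borel A -> R[i]) :
  (forall i, bm (f i)) ->
  cexpectation (power_probability (haar A) n)
    (fun t => \prod_(i < n) f i (tnth t i)) =
  \prod_(i < n) cexpectation (haar A) (f i).
Proof.
elim: n f => [|n IH] f bf.
  by under eq_cexp do rewrite big_ord0; rewrite cexp_cst big_ord0.
rewrite cexp_powerS; last first.
  apply: bm_prod => i; apply: (bm_comp _ (bf i)); exact: measurable_tnth.
under eq_cexp => x.
  under eq_cexp => t.
    rewrite big_ord_recl (tnth0 x).
    under eq_bigr do rewrite tnthS.
    over.
  rewrite cexpZ; last first.
    apply: bm_prod => i; apply: (bm_comp _ (bf (lift ord0 i))).
    exact: measurable_tnth.
  rewrite (IH (fun i => f (lift ord0 i)))//.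
  over.
by rewrite cexpZr// big_ord_recl.
Qed.

End haar_facts.

Lemma log_convex_growth (R : realType) (a : nat -> R) (C : R) :
  (forall n, 0 < a n) ->
  (forall n, a n.+1 ^+ 2 <= a n * a n.+2) ->
  (forall n, a n.*2.+1 <= a n ^+ 2) ->
  (forall n, a n.+1 <= C * a n) ->
  exists lam : R, [/\ 0 < lam, forall n, a n.+1 <= lam * a n &
    forall n, lam ^+ n.+1 <= a n].
Proof.
move=> a0 alc asq aC; pose r n := a n.+1 / a n.
have r0 n : 0 < r n by rewrite divr_gt0.
have rS n : r n <= r n.+1.
  by rewrite /r ler_pdivrMr// mulrAC ler_pdivlMr// -expr2 mulrC.
have rnd : nondecreasing_seq r by apply/nondecreasing_seqP.
have rC n : r n <= C by rewrite ler_pdivrMr.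
have cr : cvgn r.
  by apply: nondecreasing_is_cvgn => //; exists C => _ [n _ <-].
have rle n : r n <= limn r by exact: nondecreasing_cvgn_le.
exists (limn r); split.
- exact: lt_le_trans (r0 0) (rle 0).
- by move=> n; rewrite -ler_pdivrMr//; exact: rle.
- move=> n.
  have grow N : r N ^+ N.+1 <= a N.
    have h k : r N ^+ k * a N <= a (N + k)%N.
      elim: k => [|k IH]; first by rewrite expr0 mul1r addn0.
      rewrite exprS -mulrA (le_trans (ler_wpM2l (ltW (r0 _)) IH))//.
      rewrite (le_trans (ler_wpM2r (ltW (a0 _)) (rnd _ _ (leq_addr k N))))//.
      by rewrite divfK ?gt_eqF// addnS.
    have := le_trans (h N.+1) _; rewrite addnS addnn => /(_ _ (asq N)).
    by rewrite expr2 ler_pM2r.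
  have iterate i : a ((2 ^ i * n.+1).-1)%N <= a n ^+ (2 ^ i).
    elim: i => [|i IH]; first by rewrite expn0 mul1n expr1.
    have -> : ((2 ^ i.+1 * n.+1).-1 = ((2 ^ i * n.+1).-1).*2.+1)%N.
      rewrite expnS -mulnA mul2n.
      by case: (2 ^ i * n.+1)%N (muln_gt0 (2 ^ i) n.+1) => [|k]//; rewrite expn_gt0.
    rewrite (le_trans (asq _))// expnS (mulnC 2) exprM lerXn2r// nnegrE ltW//.
    by rewrite exprn_gt0.
  have rm m : r m ^+ n.+1 <= a n.
    set N := (2 ^ m * n.+1).-1.
    have NE : N.+1 = (2 ^ m * n.+1)%N by rewrite prednK// muln_gt0 expn_gt0.
    have mN : (m <= N)%N.
      by rewrite -ltnS NE (leq_trans (ltn_expl m (ltnSn 1)))// leq_pmulr.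
    rewrite (@le_trans _ _ (r N ^+ n.+1))//.
      by rewrite lerXn2r ?nnegrE ?(ltW (r0 _))//; exact: rnd.
    rewrite -(@ler_pXn2r _ (2 ^ m)) ?expn_gt0// ?nnegrE ?exprn_ge0 ?(ltW (r0 _)) ?(ltW (a0 _))//.
    by rewrite -exprM mulnC -NE (le_trans (grow N))// iterate.
  have cX : (fun m => r m ^+ n.+1) @ \oo --> limn r ^+ n.+1.
    exact: (@cvg_comp _ _ _ _ (fun x => x ^+ n.+1) _ _ _ cr (@exprn_continuous _ n.+1 _)).
  rewrite -(cvg_lim _ cX)//; apply: limr_le; first by apply/cvg_ex; eexists; exact: cX.
  by apply: nearW.
Qed.

Lemma distr_limn_le (R : realType) (w : nat -> R) (a e : R) N : cvgn w ->
  (forall m, (N <= m)%N -> `|a - w m| <= e) -> `|a - limn w| <= e.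
Proof.
move=> cw we.
have lo : a - e <= limn w.
  apply: limr_ge => //; exists N => // m /we.
  by rewrite ler_norml => /andP[_]; rewrite lerBlDr -lerBlDl.
have hi : limn w <= a + e.
  apply: limr_le => //; exists N => // m /we.
  by rewrite ler_norml lerBrDr addrC -lerBrDr opprK => /andP[].
by rewrite ler_norml; apply/andP; split; lra.
Qed.

Section uniform_limit.
Context d (T : measurableType d) (R : realType).
Implicit Types (Q : nat -> T -> R[i]) (u v : T -> R[i]).

Definition ucvg Q u := forall e : R, 0 < e ->
  exists N, forall n, (N <= n)%N -> forall x, `|Q n x - u x| <= e%:C.

Lemma ucvg_unique Q u v : ucvg Q u -> ucvg Q v -> u = v.
Proof.
move=> Qu Qv; apply/funext => x; apply/eqP; rewrite -subr_eq0 -normr_le0.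
rewrite normC_normc (_ : 0 = (0 : R)%:C)// lecR; apply/ler_addgt0Pr => e e0.
rewrite add0r -lecR -normC_normc.
have e2 : 0 < e / 2 by rewrite divr_gt0.
have [N hN] := Qu _ e2; have [N' hN'] := Qv _ e2.
rewrite (_ : e = e / 2 + e / 2); last by field.
rewrite rcD (_ : u x - v x = - (Q (maxn N N') x - u x) + (Q (maxn N N') x - v x)); last by ring.
rewrite (le_trans (ler_normD _ _))// lerD ?normrN ?hN ?hN' ?leq_maxl ?leq_maxr//.
Qed.

Lemma ucvg_sub Q u (s : nat -> nat) : (forall n, (n <= s n)%N) -> ucvg Q u ->
  ucvg (fun n => Q (s n)) u.
Proof.
move=> sn Qu e /Qu[N hN]; exists N => n Nn; apply: hN.
exact: leq_trans Nn (sn n).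
Qed.

Lemma ucvg_bm Q u : (forall n, bm (Q n)) -> ucvg Q u -> bm u.
Proof.
move=> bQ Qu; split; last first.
  have [N hN] := Qu 1 ltr01; have [_ [M QM]] := bQ N.
  exists (M + 1) => x; rewrite -[u x](subrK (Q N x)) addrC.
  by rewrite (le_trans (ler_normD _ _))// lerD// distrC; exact: hN.
have aux (h : R[i] -> R) : (forall z w, h (z - w) = h z - h w) ->
    (forall z, (`|h z|)%:C <= `|z|) -> (forall n, measurable_fun setT (h \o Q n)) ->
    measurable_fun setT (h \o u).
  move=> hB hn mh; apply: (@measurable_fun_cvg _ _ _ _ (fun n => h \o Q n)) => // x _.
  apply/cvgrPdist_le => e e0; have [N hN] := Qu _ e0.
  near=> n; rewrite -lecR/= -hB (le_trans (hn _))// distrC hN//.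
  by near: n; exists N.
split; apply: aux.
- by case=> ? ? [].
- exact: ler_Re_norm.
- by move=> n; case: (bQ n) => -[].
- by case=> ? ? [].
- exact: ler_Im_norm.
- by move=> n; case: (bQ n) => -[].
Unshelve. all: by end_near. Qed.

Lemma ucauchy_ucvg Q :
  (forall e : R, 0 < e -> exists N, forall m n, (N <= m)%N -> (N <= n)%N ->
    forall x, `|Q m x - Q n x| <= e%:C) ->
  exists u, ucvg Q u.
Proof.
move=> cQ.
have aux (h : R[i] -> R) : (forall z w, h (z - w) = h z - h w) ->
    (forall z, (`|h z|)%:C <= `|z|) ->
    forall x, cvgn (fun n => h (Q n x)).
  move=> hB hn x; apply/cauchy_cvgP/cauchy_exP => e e0.
  have [N hN] := cQ _ (divr_gt0 e0 (ltr0n R 2)).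
  exists (h (Q N x)); exists N => // m /= Nm.
  rewrite /ball/= (@le_lt_trans _ _ (e / 2))//.
    by rewrite -lecR -hB (le_trans (hn _))// hN.
  by rewrite ltr_pdivrMr// mulr_natr mulr2n ltrDl.
have cRe := aux (@complex.Re R) (@cReB R) (@ler_Re_norm R).
have cIm := aux (@complex.Im R) (@cImB R) (@ler_Im_norm R).
exists (fun x => Complex (limn (fun n => complex.Re (Q n x))) (limn (fun n => complex.Im (Q n x)))).
move=> e e0; have [N hN] := cQ _ (divr_gt0 e0 (ltr0n R 2)).
exists N => n Nn x.
have b1 : `|complex.Re (Q n x) - limn (fun n => complex.Re (Q n x))| <= e / 2.
  apply: (@distr_limn_le _ _ _ _ N (cRe x)) => m Nm; rewrite -lecR.
  by rewrite (le_trans _ (hN _ _ Nn Nm x))// (le_trans _ (ler_Re_norm _))// cReB.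
have b2 : `|complex.Im (Q n x) - limn (fun n => complex.Im (Q n x))| <= e / 2.
  apply: (@distr_limn_le _ _ _ _ N (cIm x)) => m Nm; rewrite -lecR.
  by rewrite (le_trans _ (hN _ _ Nn Nm x))// (le_trans _ (ler_Im_norm _))// cImB.
set z := _ - _.
have -> : z = (complex.Re z)%:C + 'i%C * (complex.Im z)%:C by exact: complexE.
have -> : e = e / 2 + e / 2 by field.
rewrite rcD (le_trans (ler_normD _ _))// lerD//.
  by rewrite normC_normc /= expr0n addr0 sqrtr_sqr lecR /z cReB.
rewrite normrM !normC_normc /= !expr0n/= expr1n add0r addr0 sqrtr1 sqrtr_sqr mul1r lecR.
by rewrite /z cImB.
Qed.

End uniform_limit.

(** * Convolution *)

Section convolution.
Context (R : realType) (A : compactAbelianGroup R).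
Implicit Types u v w K : borel A -> R[i].
Local Notation E := (cexpectation (haar A)).
Local Notation sq := (sqn (haar A)).

Definition convol u v : borel A -> R[i] :=
  fun x => E (fun y : borel A => u ((x : A) - y) * v y).
Definition star u : borel A -> R[i] := fun x => (u (- (x : A)))^*.

Lemma bm_shift u (a : A) : bm u -> bm (fun x : borel A => u (a + (x : A))).
Proof. by apply: bm_comp; exact: measurable_addlb. Qed.

Lemma bm_shiftr u (a : A) : bm u -> bm (fun x : borel A => u ((x : A) + a)).
Proof. by apply: bm_comp; exact: measurable_addrb. Qed.

Lemma bm_opp u : bm u -> bm (fun x : borel A => u (- (x : A))).
Proof. by apply: bm_comp; exact: measurable_oppb. Qed.

Lemma bm_reflect u (a : A) : bm u -> bm (fun x : borel A => u (a - (x : A))).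
Proof. by move=> bu; apply: (bm_opp (bm_shift a bu)). Qed.

Lemma bm_star u : bm u -> bm (star u).
Proof. by move=> bu; apply/bmJ/bm_opp. Qed.

Lemma bm_conv_kernel u v : bm u -> bm v ->
  bm (fun p : borel A * borel A => u ((p.1 : A) - p.2) * v p.2).
Proof.
move=> bu bv; apply: bmM; last by apply: (bm_comp _ bv); exact: measurable_snd.
apply: (bm_comp _ bu); apply: measurable_add2; first exact: measurable_fst.
by apply: measurable_opp1; exact: measurable_snd.
Qed.

Lemma bm_conv u v : bm u -> bm v -> bm (convol u v).
Proof. by move=> bu bv; exact: (bm_cexp1 _ (bm_conv_kernel bu bv)). Qed.

Lemma haar_reflect u (a : A) : bm u ->
  E (fun x : borel A => u (a - (x : A))) = E u.
Proof.
by move=> bu; rewrite (haar_opp (bm_shift a bu)) haar_shiftl.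
Qed.

Lemma convolC u v : bm u -> bm v -> convol u v = convol v u.
Proof.
move=> bu bv; apply/funext => x.
rewrite /convol -(@haar_reflect _ (x : A)); last first.
  by apply: bmM => //; exact: bm_reflect.
by apply: eq_cexp => y; rewrite opprB addrCA subrr addr0 mulrC.
Qed.

Lemma convolA u v w : bm u -> bm v -> bm w ->
  convol (convol u v) w = convol u (convol v w).
Proof.
move=> bu bv bw; apply/funext => x; rewrite /convol.
pose F (p : borel A * borel A) : R[i] :=
  u ((x : A) - p.1 - p.2) * v p.2 * w p.1.
have mF : measurable_fun setT (fun p : borel A * borel A =>
    (x : A) - (p.1 : A) - (p.2 : A) : borel A).
  apply: measurable_add2.
    by apply: measurable_add2 => //; apply: measurable_opp1; exact: measurable_fst.
  by apply: measurable_opp1; exact: measurable_snd.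
have bF : bm F.
  apply: bmM; last by apply: (bm_comp _ bw); exact: measurable_fst.
  apply: bmM; last by apply: (bm_comp _ bv); exact: measurable_snd.
  exact: (bm_comp mF bu).
transitivity (E (fun y => E (fun z => F (y, z)))).
  apply: eq_cexp => y; rewrite -cexpZr//.
  by apply: bmM => //; exact: (@bm_reflect u ((x : A) - y)).
have bu2 y : bm (fun z : borel A => u ((x : A) - y - z)).
  exact: (@bm_reflect u ((x : A) - y)).
pose G (p : borel A * borel A) : R[i] :=
  u ((x : A) - p.2) * (v ((p.2 : A) - p.1) * w p.1).
have mG1 : measurable_fun setT (fun p : borel A * borel A =>
    (x : A) - (p.2 : A) : borel A).
  apply: measurable_add2 => //.
  by apply: measurable_opp1; exact: measurable_snd.
have mG2 : measurable_fun setT (fun p : borel A * borel A =>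
    (p.2 : A) - (p.1 : A) : borel A).
  apply: measurable_add2; first exact: measurable_snd.
  by apply: measurable_opp1; exact: measurable_fst.
have bG : bm G.
  apply: bmM; first exact: (bm_comp mG1 bu).
  apply: bmM; first exact: (bm_comp mG2 bv).
  by apply: (bm_comp _ bw); exact: measurable_fst.
transitivity (E (fun y => E (fun z => G (y, z)))).
  apply: eq_cexp => y.
  rewrite -[RHS](@haar_shiftl _ _ (y : A)); last exact: bm_section1.
  apply: eq_cexp => z; rewrite /F /G /= (addrAC (y : A)) subrr add0r opprD addrA.
  by rewrite mulrA.
rewrite cexp_swap//; apply: eq_cexp => z.
rewrite /G/= cexpZ//; apply: bmM => //.
exact: bm_reflect.
Qed.

Lemma convolDr u v w : bm u -> bm v -> bm w ->
  convol u (fun x => v x + w x) = fun x => convol u v x + convol u w x.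
Proof.
move=> bu bv bw; apply/funext => x; rewrite /convol -cexpD.
- by apply: eq_cexp => y; rewrite mulrDr.
- by apply: bmM => //; exact: bm_reflect.
- by apply: bmM => //; exact: bm_reflect.
Qed.

Lemma convolZr u v c : bm u -> bm v ->
  convol u (fun x => c * v x) = fun x => c * convol u v x.
Proof.
move=> bu bv; apply/funext => x; rewrite /convol -cexpZ.
- by apply: eq_cexp => y; rewrite mulrCA.
- by apply: bmM => //; exact: bm_reflect.
Qed.

Lemma convolBr u v w : bm u -> bm v -> bm w ->
  convol u (fun x => v x - w x) = fun x => convol u v x - convol u w x.
Proof.
move=> bu bv bw; apply/funext => x; rewrite /convol -cexpB.
- by apply: eq_cexp => y; rewrite mulrBr.
- by apply: bmM => //; exact: bm_reflect.
- by apply: bmM => //; exact: bm_reflect.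
Qed.

Lemma convolBl u v w : bm u -> bm v -> bm w ->
  convol (fun x => v x - w x) u = fun x => convol v u x - convol w u x.
Proof.
move=> bu bv bw; rewrite convolC// ?convolBr//; last exact: bmB.
by apply/funext => x; rewrite (convolC bv bu) (convolC bw bu).
Qed.

Lemma convolDl u v w : bm u -> bm v -> bm w ->
  convol (fun x => v x + w x) u = fun x => convol v u x + convol w u x.
Proof.
move=> bu bv bw; rewrite convolC// ?convolDr//; last exact: bmD.
by apply/funext => x; rewrite (convolC bv bu) (convolC bw bu).
Qed.

Lemma convolZl u v c : bm u -> bm v ->
  convol (fun x => c * v x) u = fun x => c * convol v u x.
Proof.
move=> bu bv; rewrite convolC ?convolZr//; last exact: bmZ.
by apply/funext => x; rewrite (convolC bv bu).
Qed.

Lemma starK u : star (star u) = u.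
Proof. by apply/funext => x; rewrite /star opprK conjCK. Qed.

Lemma star_conv u v : bm u -> bm v ->
  star (convol u v) = convol (star u) (star v).
Proof.
move=> bu bv; apply/funext => x; rewrite /star /convol -cexpJ; last first.
  by apply: bmM => //; exact: bm_reflect.
rewrite -[LHS]haar_opp; last first.
  by apply: bmJ; apply: bmM => //; exact: bm_reflect.
by apply: eq_cexp => y; rewrite conjcM !opprK opprB addrC.
Qed.

Lemma conv_star0 u v : bm u -> bm v ->
  convol u (star v) 0 = E (fun x => u x * (v x)^*).
Proof.
move=> bu bv; rewrite -[RHS]haar_opp; last by apply: bmM => //; exact: bmJ.
by apply: eq_cexp => y; rewrite add0r.
Qed.

Lemma sqn_reflect u (a : A) : bm u -> sq (fun x : borel A => u (a - (x : A))) = sq u.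
Proof. by move=> bu; exact: (haar_reflect a (bm_sq bu)). Qed.

Lemma sqn_conj u : sq (fun x => (u x)^*) = sq u.
Proof. by apply: eq_cexp => x; rewrite conjCK mulrC. Qed.

Lemma conv_norm_le u v (x : borel A) : bm u -> bm v ->
  `|convol u v x| ^+ 2 <= sq u * sq v.
Proof.
move=> bu bv; rewrite -(sqn_reflect (x : A) bu) -(sqn_conj v).
have := cauchy_schwarz (haar A) (bm_reflect (x : A) bu) (bmJ bv).
by under [X in `|X|]eq_cexp do rewrite conjCK.
Qed.

Lemma sqn_bound u (C : R[i]) : bm u -> (forall x, `|u x| ^+ 2 <= C) -> sq u <= C.
Proof.
move=> bu uC; rewrite -[leRHS](cexp_cst (haar A)); apply: le_cexp => [||x].
- exact: bm_sq.
- exact: bm_cst.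
- by rewrite -normCK.
Qed.

Lemma sqn_conv u v : bm u -> bm v -> sq (convol u v) <= sq u * sq v.
Proof.
by move=> bu bv; apply: sqn_bound => [|x]; [exact: bm_conv|exact: conv_norm_le].
Qed.

Lemma conv_adjoint u v w : bm u -> bm v -> bm w ->
  E (fun x => convol u v x * (w x)^*) = E (fun x => v x * (convol (star u) w x)^*).
Proof.
move=> bu bv bw.
pose F (p : borel A * borel A) : R[i] :=
  u ((p.1 : A) - p.2) * v p.2 * (w p.1)^*.
have bF : bm F.
  apply: bmM; first exact: bm_conv_kernel.
  by apply: bmJ; apply: (bm_comp _ bw); exact: measurable_fst.
transitivity (E (fun x => E (fun y => F (x, y)))).
  apply: eq_cexp => x; rewrite -cexpZr//.
  by apply: bmM => //; exact: bm_reflect.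
rewrite cexp_swap//; apply: eq_cexp => y.
rewrite /convol -cexpJ; last first.
  by apply: bmM => //; apply: bm_reflect; exact: bm_star.
rewrite -cexpZ; last first.
  by apply: bmJ; apply: bmM => //; apply: bm_reflect; exact: bm_star.
apply: eq_cexp => x; rewrite /F /star/= conjcM conjCK opprB.
ring.
Qed.

Lemma ucvg_conv (Q Q' : nat -> borel A -> R[i]) u v :
  (forall n, bm (Q n)) -> (forall n, bm (Q' n)) ->
  ucvg Q u -> ucvg Q' v -> ucvg (fun n => convol (Q n) (Q' n)) (convol u v).
Proof.
move=> bQ bQ' Qu Qv; have bu := ucvg_bm bQ Qu; have bv := ucvg_bm bQ' Qv.
have bound (f : borel A -> R[i]) : bm f -> exists2 M : R, 0 < M & forall x, `|f x| <= M%:C.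
  move=> [_ [M fM]]; have M0 : 0 <= M by rewrite (le_trans _ (fM point)).
  exists (complex.Re M + 1).
    by rewrite ltr_wpDl// -ler0c RRe_real ?ger0_real.
  move=> x; rewrite (le_trans (fM x))// rcD RRe_real ?ger0_real//.
  by rewrite lerDl ler01.
have [M M0 uM] := bound _ bu; have [N N0 vN] := bound _ bv.
move=> e e0.
pose e1 := Num.min 1 (e / (M + N + 1)).
have e10 : 0 < e1 by rewrite lt_min ltr01 divr_gt0// !addr_gt0.
have e1e : e1 * (N + 1) + M * e1 <= e.
  have : e1 <= e / (M + N + 1) by rewrite ge_min lexx orbT.
  rewrite ler_pdivlMr; last by rewrite !addr_gt0.
  by apply: le_trans; rewrite le_eqVlt; apply/orP; left; apply/eqP; ring.
have [n1 h1] := Qu _ e10; have [n2 h2] := Qv _ e10.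
exists (maxn n1 n2) => n; rewrite geq_max => /andP[nn1 nn2] x.
have bk1 : bm (fun y : borel A => Q n ((x : A) - y) * Q' n y).
  by apply: bmM => //; exact: bm_reflect.
have bk2 : bm (fun y : borel A => u ((x : A) - y) * v y).
  by apply: bmM => //; exact: bm_reflect.
rewrite /convol -cexpB//.
apply: (@le_trans _ _ (e1 * (N + 1) + M * e1)%:C); last by rewrite lecR.
apply: norm_cexp_le => [|y]; first exact: bmB.
rewrite (_ : _ - _ = (Q n ((x : A) - y) - u ((x : A) - y)) * Q' n y +
   u ((x : A) - y) * (Q' n y - v y)); last by ring.
rewrite (le_trans (ler_normD _ _))// rcD lerD// normrM rcM ler_pM//.
- exact: h1.
- rewrite -[Q' n y](subrK (v y)) (le_trans (ler_normD _ _))// addrC rcD lerD//.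
  by rewrite (le_trans (h2 _ nn2 _))// lecR ge_min lexx.
- exact: h2.
Qed.

Lemma ucvg_star (Q : nat -> borel A -> R[i]) u :
  ucvg Q u -> ucvg (fun n => star (Q n)) (star u).
Proof.
move=> Qu e /Qu[N hN]; exists N => n Nn x.
by rewrite /star -[X in `|X|](rmorphB Num.conj) norm_conjC; exact: hN.
Qed.

End convolution.

Section idempotents.
Context (R : realType) (A : compactAbelianGroup R).
Implicit Types u v w K P : borel A -> R[i].
Local Notation E := (cexpectation (haar A)).
Local Notation sq := (sqn (haar A)).

Lemma sqnB u v : bm u -> bm v -> sq (fun x => u x - v x) =
  sq u - E (fun x => u x * (v x)^*) - (E (fun x => u x * (v x)^*))^* + sq v.
Proof.
move=> bu bv.
have buv : bm (fun x => u x * (v x)^*) by apply: bmM => //; exact: bmJ.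
rewrite -cexpJ//.
transitivity (E (fun x => u x * (u x)^* - u x * (v x)^* - (u x * (v x)^*)^*
    + v x * (v x)^*)).
  apply: eq_cexp => x; rewrite conjcD conjcN conjcM conjCK; ring.
have b1 := bm_sq bu; have b2 := bmB b1 buv; have b3 := bmJ buv.
by rewrite cexpD ?cexpB//; [exact: bmB|exact: bm_sq].
Qed.

Lemma dotZ c c' u v : bm u -> bm v -> E (fun x => c * u x * (c' * v x)^*) =
  c * c'^* * E (fun x => u x * (v x)^*).
Proof.
move=> bu bv; rewrite -cexpZ; last by apply: bmM => //; exact: bmJ.
by apply: eq_cexp => x; rewrite conjcM; ring.
Qed.

Section convolution_powers.
Variable K : borel A -> R[i].
Hypotheses (bK : bm K) (sK : star K = K).

Definition convpow n := iter n (convol K) K.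

Lemma bm_convpow n : bm (convpow n).
Proof. by elim: n => [//|n IH]; exact: bm_conv. Qed.

Lemma star_convpow n : star (convpow n) = convpow n.
Proof.
by elim: n => [//|n IH] /=; rewrite star_conv ?sK ?IH//; exact: bm_convpow.
Qed.

Lemma convpowD m n : convol (convpow m) (convpow n) = convpow (m + n).+1.
Proof.
elim: m => [//|m IH] /=; rewrite convolA ?IH//; exact: bm_convpow.
Qed.

Lemma dot_convpow m n :
  E (fun x => convpow m x * (convpow n x)^*) = convpow (m + n).+1 0.
Proof.
by rewrite -conv_star0 ?star_convpow ?convpowD//; exact: bm_convpow.
Qed.

Lemma convpow_idempotent : 0 < sq (convol K K) ->
  exists (lam : R) P, [/\ 0 < lam,
    [/\ bm P, star P = P, convol P P = P & P 0 != 0],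
    convol (convol K K) P = (fun x => lam%:C * P x) &
    sq (convol K K) <= lam%:C * sq K].
Proof.
move=> K2.
have [a aE] : exists a : nat -> R, forall n, sq (convpow n) = (a n)%:C.
  exists (fun n => complex.Re (sq (convpow n))) => n.
  by rewrite rc_ge0// sqn_ge0.
have a_ge0 n : 0 <= a n by rewrite -ler0c -aE sqn_ge0.
have a0E n : convpow (n + n).+1 0 = (a n)%:C by rewrite -dot_convpow -aE.
have alc n : a n.+1 ^+ 2 <= a n * a n.+2.
  have nE : (n + n.+2 = n.+1 + n.+1)%N by rewrite addnS addSn addnS.
  rewrite -lecR rcX rcM -!aE -(ger0_norm (sqn_ge0 (haar A) (convpow n.+1))).
  rewrite (aE n.+1) -a0E -nE -dot_convpow.
  exact: cauchy_schwarz (bm_convpow n) (bm_convpow n.+2).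
have asq n : a n.*2.+1 <= a n ^+ 2.
  rewrite -lecR -aE -addnn; apply: sqn_bound; first exact: bm_convpow.
  move=> x; rewrite -convpowD rcX -aE expr2.
  by apply: conv_norm_le; exact: bm_convpow.
have aC n : a n.+1 <= a 0 * a n.
  rewrite -lecR rcM -!aE; apply: sqn_conv => //; exact: bm_convpow.
have a_gt0 n : 0 < a n.
  have a1 : 0 < a 1 by rewrite -ltcR -aE.
  suff : 0 < a n /\ 0 < a n.+1 by case.
  elim: n => [|n [an an1]]; split => //.
    rewrite lt_neqAle a_ge0 andbT eq_sym; apply/eqP => a00.
    by have := alc 0; rewrite a00 mul0r leNgt exprn_gt0.
  rewrite lt_neqAle a_ge0 andbT eq_sym; apply/eqP => a00.
  by have := alc n; rewrite a00 mulr0 leNgt exprn_gt0.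
have [lam [lam0 alam lama]] := log_convex_growth a_gt0 alc asq aC.
pose b n := a n / lam ^+ n.+1.
have lamX n : 0 < lam ^+ n by rewrite exprn_gt0.
have b1 n : 1 <= b n by rewrite ler_pdivlMr// mul1r.
have bS n : b n.+1 <= b n.
  rewrite /b ler_pdivrMr// mulrAC ler_pdivlMr// [lam ^+ n.+2]exprS.
  by rewrite mulrA [_ * lam]mulrC ler_wpM2r// ltW.
have bni : nonincreasing_seq b by apply/nonincreasing_seqP.
have cb : cvgn b.
  by apply: nonincreasing_is_cvgn => //; exists 1 => _ [n _ <-].
pose Q n : borel A -> R[i] := fun x => (lam ^- n.+1)%:C * convpow (n + n).+1 x.
have bQ n : bm (Q n) by apply: bmZ; exact: bm_convpow.
have dotQ m n : E (fun x => Q m x * (Q n x)^*) = (b (m + n).+1)%:C.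
  rewrite dotZ; [|exact: bm_convpow..].
  rewrite dot_convpow (_ : (_ + _).+1 = ((m + n).+1 + (m + n).+1).+1)%N; last first.
    by rewrite !addSn !addnS addnACA.
  rewrite a0E rcJ -!rcM /b; congr (_%:C).
  by rewrite -invfM -exprD mulrC addSn addnS.
have sqQ m n : sq (fun x => Q m x - Q n x) =
    (b (m + m).+1 - b (m + n).+1 - b (m + n).+1 + b (n + n).+1)%:C.
  rewrite sqnB// -[sq (Q m)]/(E (fun x => Q m x * (Q m x)^*)).
  rewrite -[sq (Q n)]/(E (fun x => Q n x * (Q n x)^*)) !dotQ rcJ.
  by rewrite !(rcD, rcN).
pose M := convol K K.
have bM : bm M by exact: bm_conv.
have QS n : Q n.+1 = fun x => (lam^-1)%:C * convol M (Q n) x.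
  apply/funext => x; rewrite /Q convolZr//; last exact: bm_convpow.
  rewrite (convpowD 1) mulrA -rcM -invfM -exprS.
  by congr (_ * convpow _ x); rewrite !addSn addnS.
have [P QP] : exists P, ucvg Q P.
  apply: ucauchy_ucvg => e e0.
  have sM := sqn_ge0 (haar A) M.
  pose D := lam ^- 2 * complex.Re (sq M) + 1.
  have D0 : 0 < D.
    rewrite ltr_wpDl//; apply: mulr_ge0.
      by rewrite invr_ge0 exprn_ge0// ltW.
    by rewrite -ler0c RRe_real ?ger0_real.
  have [N Nb] : exists N, b N <= limn b + e ^+ 2 / (2 * D).
    have eD : 0 < e ^+ 2 / (2 * D) by rewrite divr_gt0 ?exprn_gt0// mulr_gt0.
    have /cvgrPdist_le/(_ _ eD)[N _ hN] := cb.
    exists N; have := hN N (leqnn N); rewrite ler_distl => /andP[]; lra.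
  exists N.+1 => -[//|m] [//|n]; rewrite !ltnS => Nm Nn x.
  have bl k : limn b <= b k by exact: nonincreasing_cvgn_ge.
  have bN k : (N <= k)%N -> b k <= limn b + e ^+ 2 / (2 * D).
    by move=> Nk; rewrite (le_trans _ Nb)//; exact: bni.
  have small : b (m + m).+1 - b (m + n).+1 - b (m + n).+1 + b (n + n).+1 <= e ^+ 2 / D.
    have -> : e ^+ 2 / D = 2 * (e ^+ 2 / (2 * D)) by field; rewrite gt_eqF.
    have := bl (m + n).+1; have := bN (m + m).+1; have := bN (n + n).+1.
    move=> /(_ (leqW (leq_trans Nn (leq_addr _ _)))) h1.
    move=> /(_ (leqW (leq_trans Nm (leq_addr _ _)))) h2; lra.
  rewrite -(@ler_pXn2r _ 2)// ?nnegrE ?ler0c ?(ltW e0)//.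
  have -> : Q m.+1 x - Q n.+1 x =
      (lam^-1)%:C * convol M (fun y => Q m y - Q n y) x.
    by rewrite !QS convolBr// mulrBr.
  rewrite normrM exprMn.
  rewrite (@le_trans _ _ (`|(lam^-1)%:C| ^+ 2 * (sq M * sq (fun x => Q m x - Q n x))))//.
    rewrite ler_wpM2l ?exprn_ge0//; apply: conv_norm_le => //; exact: bmB.
  rewrite sqQ -(rc_ge0 sM) ger0_norm ?ler0c ?invr_ge0 ?(ltW lam0)//.
  rewrite -!rcX -!rcM lecR exprVn mulrA.
  rewrite (@le_trans _ _ (lam ^- 2 * complex.Re (sq M) * (e ^+ 2 / D)))//.
    rewrite ler_wpM2l//; apply: mulr_ge0.
      by rewrite invr_ge0 exprn_ge0// ltW.
    by rewrite -ler0c RRe_real ?ger0_real.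
  rewrite mulrCA -[leRHS]mulr1 ler_wpM2l ?exprn_ge0 ?(ltW e0)//.
  by rewrite ler_pdivrMr// mul1r lerDl.
have bP := ucvg_bm bQ QP.
exists lam, P; split => //.
- split => //.
  + apply: (ucvg_unique (ucvg_star QP)).
    rewrite (_ : (fun n => _) = Q)//; apply/funext => n; apply/funext => x.
    by rewrite /star /Q conjcM rcJ -[in RHS](star_convpow).
  + apply: (ucvg_unique (ucvg_conv bQ bQ QP QP)).
    rewrite (_ : (fun n => _) = fun n => Q (n + n).+1).
      by apply: ucvg_sub QP => n; rewrite leqW// leq_addr.
    apply/funext => n; apply/funext => x.
    have e1 : convol (Q n) (Q n) = fun y => (lam ^- n.+1)%:C *
        convol (convpow (n + n).+1) (Q n) y :=
      convolZl (lam ^- n.+1)%:C (bQ n) (bm_convpow _).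
    have e2 : convol (convpow (n + n).+1) (Q n) = fun y => (lam ^- n.+1)%:C *
        convol (convpow (n + n).+1) (convpow (n + n).+1) y :=
      convolZr (lam ^- n.+1)%:C (bm_convpow _) (bm_convpow _).
    rewrite e1 e2 /Q.
    rewrite convpowD mulrA -rcM -invfM -exprD.
    by congr ((lam ^- _)%:C * convpow _ x); rewrite !addSn !addnS.
  + apply/eqP => P0; have [N hN] := QP _ (divr_gt0 ltr01 (ltr0n R 2)).
    have := hN N (leqnn N) 0; rewrite P0 subr0 /Q a0E -rcM.
    rewrite mulrC -/(b N) ger0_norm ?ler0c ?(le_trans ler01)// lecR.
    by have := b1 N; lra.
- have bQc (n : nat) : bm ((fun=> M) n : borel A -> R[i]) by [].
  have Mc : ucvg (fun=> M) M.
    by move=> e e0; exists 0%N => n _ x; rewrite subrr normr0 ler0c ltW.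
  apply: (ucvg_unique (ucvg_conv bQc bQ Mc QP)) => e e0.
  have [N hN] := QP _ (divr_gt0 e0 lam0); exists N => n Nn x.
  have -> : convol M (Q n) x = lam%:C * Q n.+1 x.
    by rewrite QS mulrA -rcM divff ?gt_eqF// mul1r.
  rewrite -mulrBr normrM ger0_norm ?ler0c ?(ltW lam0)//.
  have -> : e = lam * (e / lam) by rewrite mulrC divfK ?gt_eqF.
  by rewrite rcM ler_wpM2l ?ler0c ?(ltW lam0)// hN// leqW.
- by rewrite -[X in X <= _]/(sq (convpow 1)) -[sq K]/(sq (convpow 0)) !aE -rcM lecR.
Qed.

End convolution_powers.

End idempotents.

(** * Minimal idempotents and characters *)

Section minimal_idempotents.
Context (R : realType) (A : compactAbelianGroup R).
Implicit Types u v w K P : borel A -> R[i].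
Local Notation E := (cexpectation (haar A)).
Local Notation sq := (sqn (haar A)).

Definition idempotent P :=
  [/\ bm P, star P = P, convol P P = P & P 0 != 0].

Lemma idempotent0 P : bm P -> star P = P -> convol P P = P -> P 0 = sq P.
Proof. by move=> bP sP PP; rewrite -{1}PP -{2}sP conv_star0. Qed.

Lemma idempotent_norm_le P x : bm P -> star P = P -> convol P P = P ->
  `|P x| <= P 0.
Proof.
move=> bP sP PP; rewrite (idempotent0 bP sP PP).
rewrite -(@ler_pXn2r _ 2)// ?nnegrE ?sqn_ge0// [leRHS]expr2 -{1}PP.
exact: conv_norm_le.
Qed.

Lemma idempotent_ge1 P : idempotent P -> 1 <= P 0.
Proof.
move=> [bP sP PP P0]; have := idempotent0 bP sP PP => e0.
have p0 : 0 < P 0 by rewrite lt_def P0 e0 sqn_ge0.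
rewrite -(ler_pM2l p0) mulr1 -expr2 {1}e0; apply: sqn_le => // x.
exact: idempotent_norm_le.
Qed.

Lemma idempotentB P P' : idempotent P -> idempotent P' -> convol P P' = P' ->
  P' <> P -> P' 0 + 1 <= P 0.
Proof.
move=> [bP sP PP _] [bP' sP' PP' _] PP'' P'P.
have bD : bm (fun x => P x - P' x) by exact: bmB.
have sD : star (fun x => P x - P' x) = fun x => P x - P' x.
  apply/funext => x; rewrite /star -[in RHS]sP -[in RHS]sP' /star.
  by rewrite conjcD conjcN.
have DD : convol (fun x => P x - P' x) (fun x => P x - P' x) =
    fun x => P x - P' x.
  rewrite convolBr// !convolBl// PP PP' (convolC bP' bP) PP''.
  by apply/funext => x; rewrite subrr subr0.
rewrite -lerBrDl; apply: (@idempotent_ge1 (fun x => P x - P' x)); split => //.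
apply/eqP => D0; apply: P'P; apply/funext => x.
have := idempotent_norm_le x bD sD DD.
by rewrite D0 normr_le0 subr_eq0 => /eqP.
Qed.

Definition minimal_idempotent P := idempotent P /\
  forall P', idempotent P' -> convol P P' = P' -> P' = P.

Lemma exists_minimal_idempotent P : idempotent P ->
  exists P0, minimal_idempotent P0 /\ convol P P0 = P0.
Proof.
move=> iP.
have [n Pn] : exists n : nat, P 0 < n%:R.
  have [bP sP PP _] := iP; have P0 := idempotent0 bP sP PP.
  have rP : P 0 \is Num.real by rewrite P0 ger0_real// sqn_ge0.
  exists (Num.truncn (complex.Re (P 0))).+1.
  rewrite -(RRe_real rP) -rc_nat ltcR.
  by rewrite truncnS_gt.
elim: n P iP Pn => [|n IH] P iP Pn.
  by have := le_lt_trans (idempotent_ge1 iP) Pn; rewrite ltr10.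
have [mP|] := pselect (minimal_idempotent P).
  by exists P; split => //; case: iP.
move=> /not_andP[//|/existsNP[P' /not_implyP[iP' /not_implyP[PP' P'P]]]].
have [|P0 [mP0 P'P0]] := IH P' iP'.
  have := idempotentB iP iP' PP' P'P.
  by move=> /le_lt_trans/(_ Pn); rewrite -natr1 ltrD2r.
exists P0; split => //.
have [[bP0 _ _ _] _] := mP0; have [bP' _ _ _] := iP'; have [bP _ _ _] := iP.
by rewrite -{1}P'P0 -convolA// PP'.
Qed.

Lemma minimal_idempotent_square P K : minimal_idempotent P -> bm K ->
  star K = K -> convol K P = K ->
  exists c : R[i], convol K K = fun x => c * P x.
Proof.
move=> [iP mP] bK sK KP; have [bP sP PP P0] := iP.
have bM : bm (convol K K) by exact: bm_conv.
have MP : convol (convol K K) P = convol K K by rewrite convolA// KP.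
have [M0|M0] := eqVneq (sq (convol K K)) 0.
  exists 0; apply/funext => x; rewrite mul0r; apply/eqP.
  rewrite -normr_le0 -(@ler_pXn2r _ 2)// ?nnegrE//.
  rewrite -MP (le_trans (conv_norm_le x bM bP))// M0 mul0r expr0n.
  by [].
have Mp : 0 < sq (convol K K) by rewrite lt_def M0 sqn_ge0.
have [lam [P' [lam0 iP' MP' _]]] := convpow_idempotent bK sK Mp.
have [bP' sP' PP' _] := iP'.
have P'P : P' = P.
  apply: mP => //.
  have P'E : P' = fun x => (lam^-1)%:C * convol (convol K K) P' x.
    apply/funext => x; rewrite MP' mulrA -rcM mulVf ?gt_eqF//.
    by rewrite mul1r.
  have e1 : convol P (convol (convol K K) P') = convol (convol K K) P'.
    by rewrite -(convolA bP bM bP') (convolC bP bM) MP.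
  have e2 := convolZr (lam^-1)%:C bP (bm_conv bM bP').
  by rewrite e1 -P'E in e2.
by exists lam%:C; rewrite -MP -{1}P'P MP' P'P.
Qed.

(* Every hermitian element of the ideal of [P] has a square proportional to
   [P]; applied to [K] and to [K + P], this makes [K] proportional to [P]. *)
Lemma minimal_idempotent_scalar P K : minimal_idempotent P -> bm K ->
  star K = K -> convol K P = K -> exists c : R[i], K = fun x => c * P x.
Proof.
move=> mP bK sK KP; have [[bP sP PP P0] _] := mP.
have [c1 K1] := minimal_idempotent_square mP bK sK KP.
have bS : bm (fun x => K x + P x) by exact: bmD.
have [] := @minimal_idempotent_square P (fun x => K x + P x) mP bS.
- apply/funext => x; rewrite /star -[in RHS]sP -[in RHS]sK /star.
  by rewrite conjcD.
- by rewrite convolDl// KP PP.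
move=> c2; rewrite convolDr// !convolDl// K1 KP (convolC bP bK) KP PP => K2.
exists ((c2 - c1 - 1) / 2); apply/funext => x.
have /(congr1 (fun f => f x)) := K2; rewrite /= => e.
have -> : (c2 - c1 - 1) / 2 * P x = (c2 * P x - c1 * P x - P x) / 2 by field.
by rewrite -e; field.
Qed.

Lemma minimal_idempotent_mult P : minimal_idempotent P ->
  forall x y : A, P (x + y) * P 0 = P x * P y.
Proof.
move=> mP; have [[bP sP PP P0] _] := mP.
pose t y : borel A -> R[i] := fun x => P ((x : A) + y).
have bt y : bm (t y) by exact: bm_shiftr.
have tP y : convol (t y) P = t y.
  apply/funext => x; rewrite [RHS]/t -[in RHS]PP /t; apply: eq_cexp => z.
  by rewrite addrAC.
have st y : star (t y) = t (- y).
  apply/funext => x; rewrite /star /t -[in RHS]sP /star.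
  by rewrite opprD opprK.
move=> x y; have bty := bt y; have btN := bt (- y).
have cases : exists c : R[i], t y = fun x => c * P x.
  have [|||c1 h1] := @minimal_idempotent_scalar P (fun x => t y x + t (- y) x) mP.
  - exact: bmD.
  - apply/funext => z; rewrite /star conjcD addrC.
    rewrite -[(t y _)^*]/(star (t y) z) -[(t (- y) _)^*]/(star (t (- y)) z).
    by rewrite !st opprK.
  - by rewrite convolDl// !tP.
  have [|||c2 h2] := @minimal_idempotent_scalar P
      (fun x => 'i * (t y x - t (- y) x)) mP.
  - by apply: bmZ; exact: bmB.
  - apply/funext => z; rewrite /star conjcM conjcD conjcN conjCi.
    rewrite -[(t y _)^*]/(star (t y) z) -[(t (- y) _)^*]/(star (t (- y)) z).
    by rewrite !st opprK mulNr -mulrN opprB.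
  - by rewrite convolZl ?convolBl ?tP//; exact: bmB.
  exists ((c1 - 'i * c2) / 2); apply/funext => z.
  have /(congr1 (fun f => f z)) e1 := h1; have /(congr1 (fun f => f z)) e2 := h2.
  rewrite /= in e1 e2.
  have -> : (c1 - 'i * c2) / 2 * P z = (c1 * P z - 'i * (c2 * P z)) / 2 by ring.
  have ii : 'i * 'i = -1 :> R[i] by rewrite -expr2 sqrCi.
  by rewrite -e1 -e2 mulrA ii; field.
have [c tc] := cases.
have e0 : P y = c * P 0 by rewrite -[P y]/(P y) -[in LHS](add0r y) -[LHS]/(t y 0) tc.
have ex : P (x + y) = c * P x by rewrite -[LHS]/(t y x) tc.
by rewrite e0 ex; ring.
Qed.

End minimal_idempotents.

Lemma cexp_limit_eq0 d (T : measurableType d) (R : realType)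
    (P : probability T R) (F : nat -> T -> R[i]) (f : T -> R[i]) (C : R) :
  (forall n, bm (F n)) -> bm f -> (forall n x, `|F n x| <= C%:C) ->
  (forall x, exists N, forall n, (N <= n)%N -> F n x = f x) ->
  (forall n, cexpectation P (F n) = 0) -> cexpectation P f = 0.
Proof.
move=> bF bf FC Ff F0.
have aux (h : R[i] -> R) : (forall z, (`|h z|)%:C <= `|z|) ->
    (forall n, measurable_fun setT (fun x => h (F n x))) ->
    measurable_fun setT (fun x => h (f x)) ->
    (forall n, \int[P]_x h (F n x) = 0) -> \int[P]_x h (f x) = 0.
  move=> hn mF mf hF.
  have bnd n x : `|h (F n x)| <= C by rewrite -lecR (le_trans (hn _)).
  have [|||||_ _] := @dominated_convergence _ T R P setT measurableT
      (fun n x => (h (F n x))%:E) (fun x => (h (f x))%:E) (cst C%:E).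
  - by move=> n; exact/measurable_EFinP.
  - exact/measurable_EFinP.
  - apply: aeW => x _; apply: cvg_near_cst; have [N hN] := Ff x.
    by exists N => // n /= Nn; rewrite hN.
  - exact: finite_measure_integrable_cst.
  - by apply: aeW => x n _ /=; rewrite lee_fin.
  move=> cv.
  have z0 : [sequence (\int[P]_x (h (F n x))%:E)%E]_n = cst 0%E.
    apply/funext => n /=; have := hF n; rewrite /Rintegral => e0.
    rewrite -[LHS]fineK ?e0//; apply: integrable_fin_num => //.
    exact: (bounded_integrable _ (mF n) (bnd n)).
  rewrite z0 in cv; rewrite /Rintegral.
  by rewrite -(cvg_lim (@ereal_hausdorff R) cv) lim_cst.
apply: complex_ext.
  apply: (aux (@complex.Re R)).
  - exact: ler_Re_norm.
  - by move=> n; case: (bF n) => -[].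
  - by case: bf => -[].
  - by move=> n; rewrite -[RHS]/(complex.Re (0 : R[i])) -(F0 n).
apply: (aux (@complex.Im R)).
- exact: ler_Im_norm.
- by move=> n; case: (bF n) => -[].
- by case: bf => -[].
- by move=> n; rewrite -[RHS]/(complex.Im (0 : R[i])) -(F0 n).
Qed.

Section continuity_of_characters.
Context (R : realType) (A : compactAbelianGroup R).
Local Notation E := (cexpectation (haar A)).

Lemma open_indicator_approx (U : set A) : open U ->
  exists u : nat -> A -> R, [/\ forall n, continuous (u n),
    forall n x, 0 <= u n x <= 1 &
    forall x, exists N, forall n, (N <= n)%N -> u n x = \1_U x].
Proof.
move=> oU.
have normA := compact_normal (@cag_hausdorff _ A) (@cag_compact _ A).
have [e [eo eb]] := countable_basis A.
pose G i := if `[< closure (e i) `<=` U >] then closure (e i) else set0.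
pose F n := \big[setU/set0]_(i < n) G i.
have cF n : closed (F n).
  apply: closed_bigsetU => i _; rewrite /G; case: ifP => _.
    exact: closed_closure.
  exact: closed0.
have FU n : F n `<=` U.
  rewrite /F -bigcup_mkord => x [i _]; rewrite /G.
  by case: asboolP => [h /h|].
have sep n : exists f : A -> R, [/\ continuous f, range f `<=` `[0, 1],
    f @` (~` U) `<=` [set 0] & f @` (F n) `<=` [set 1]].
  apply/uniform_separatorP.
  have nsep := (@normal_separatorP R A).1 normA.
  apply: nsep.
  - exact: open_closedC.
  - exact: cF.
  - by apply/seteqP; split => // x [Ux /FU].
have [u hu] := choice sep; exists u; split.
- by move=> n; have [] := hu n.
- by move=> n x; have [_ h _ _] := hu n; have := h (u n x) (ex_intro2 _ _ x I erefl);
    rewrite /= in_itv.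
move=> x; have [Ux|nUx] := pselect (U x); last first.
  exists 0%N => n _; rewrite indicE memNset//.
  by have [_ _ h _] := hu n; exact: h (u n x) (ex_intro2 _ _ x nUx erefl).
have xU : nbhs x U by exact: open_nbhs_nbhs.
have [V xV VU] : filter_from (nbhs x) closure U.
  exact: (@compact_regular A x setT (@cag_hausdorff _ A) (@cag_compact _ A) filterT).
have [i [ix iV]] := eb _ _ xV.
exists i.+1 => n ni; rewrite indicE mem_set//.
have [_ _ _ h] := hu n; apply: (h (u n x)); exists x => //.
rewrite /F -bigcup_mkord; exists i => //=; rewrite /G.
case: asboolP => [_|[]]; first exact: subset_closure.
by move=> z /(closureS iV); exact: VU.
Qed.

End continuity_of_characters.

Section inverse_theorem.
Context (R : realType) (A : compactAbelianGroup R).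
Implicit Types u v h chi : borel A -> R[i].
Local Notation E := (cexpectation (haar A)).
Local Notation sq := (sqn (haar A)).

Lemma bm_real (u : A -> R) : continuous u -> (forall x, `|u x| <= 1) ->
  bm (fun x : borel A => (u x)%:C).
Proof.
move=> cu u1; split.
  by split; [exact: continuous_measurable_real|exact: measurable_cst].
by exists 1 => x; rewrite rc_norm lecR.
Qed.

Lemma continuous_test_function chi : bm chi -> sq chi != 0 ->
  exists u : A -> R, [/\ continuous u, forall x, `|u x| <= 1 &
    E (fun x => chi x * (u x)%:C) != 0].
Proof.
move=> bchi; apply: contra_neqP => /forallNP nou.
have zero (u : A -> R) : continuous u -> (forall x, `|u x| <= 1) ->
    E (fun x => chi x * (u x)%:C) = 0.
  move=> cu u1; apply: contrapT => /eqP u0; apply: (nou u).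
  by split.
apply: (@pi_system_sqn_eq0 _ (borel A) R (haar A) (@open A)) => //.
- by move=> U V oU oV; exact: openI.
- exact: openT.
move=> U oU; have [u [cu u01 uU]] := open_indicator_approx oU.
have u1 n x : `|u n x| <= 1.
  by have /andP[u0 ?] := u01 n x; rewrite ger0_norm.
have [_ [M chiM]] := bchi.
have M0 : 0 <= M by rewrite (le_trans _ (chiM point)).
apply: (@cexp_limit_eq0 _ _ _ _ (fun n x => chi x * (u n x)%:C) _ (complex.Re M)).
- by move=> n; apply: bmM => //; exact: bm_real.
- by apply: bmM => //; apply: bm_indic; exact: open_borel.
- move=> n x; rewrite rc_ge0// normrM -[leRHS]mulr1 ler_pM//.
  by rewrite rc_norm lecR.
- by move=> x; have [N hN] := uU x; exists N => n /hN ->.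
- by move=> n; exact: zero.
Qed.

Lemma translate_near_uniform (u : A -> R) (y0 : A) (e : R) : continuous u ->
  0 < e -> \forall y \near y0, forall x, `|u (x - y) - u (x - y0)| <= e.
Proof.
move=> cu e0.
have cov := (compact_near_coveringP _).1 (@cag_compact _ A).
have cuv (x y : A) : {for (x, y), continuous (fun p : A * A => u (p.1 - p.2))}.
  apply: (@continuous_comp _ _ _ (fun p : A * A => p.1 - p.2) u).
    exact: sub_continuous.
  exact: cu.
suff : \forall y \near y0, [set: A] `<=` (fun x => `|u (x - y) - u (x - y0)| <= e).
  by apply: filterS => y h x; exact: h.
apply: (cov A (nbhs y0) (fun y x => `|u (x - y) - u (x - y0)| <= e)) => x _.
have e2 : 0 < e / 2 by rewrite divr_gt0.
have h1 : \forall x' \near x & y \near y0, `|u (x - y0) - u (x' - y)| <= e / 2.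
  by have /cvgrPdist_le/(_ _ e2) := cuv x y0.
have [[V W] [/= nV nW] VW] := h1.
exists (V, W) => // -[x' y] [/= Vx' Wy].
have := VW (x', y) (conj Vx' Wy).
have := VW (x', y0) (conj Vx' (nbhs_singleton nW)).
rewrite /= !ler_norml => /andP[? ?] /andP[? ?]; apply/andP; split; lra.
Qed.

Lemma measurable_character_continuous chi : bm chi ->
  (forall x y : A, chi (x + y) = chi x * chi y) -> (forall x, `|chi x| = 1) ->
  continuous (chi : A -> R[i]^o).
Proof.
move=> bchi chiD chi1.
have [u [cu u1 c0]] : exists u : A -> R, [/\ continuous u, forall x, `|u x| <= 1 &
    E (fun x => chi x * (u x)%:C) != 0].
  apply: continuous_test_function => //.
  rewrite /sqn; under eq_cexp do rewrite -normCK chi1 expr1n.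
  by rewrite cexp_cst oner_eq0.
set c := E _ in c0.
have bu : bm (fun x : borel A => (u x)%:C) by exact: bm_real.
have buy y : bm (fun x : borel A => (u ((x : A) - y))%:C).
  exact: (bm_shiftr (- y) bu).
have chiE y : chi y * c = E (fun x => chi x * (u ((x : A) - y))%:C).
  rewrite -[RHS](haar_shiftr y); last exact: bmM.
  rewrite /c -cexpZ; last exact: bmM.
  by apply: eq_cexp => x; rewrite chiD addrK; ring.
move=> y0; apply/cvgrPdist_le => e e0.
have cp : 0 < `|c| by rewrite normr_gt0.
have eE : e = (complex.Re e)%:C by rewrite rc_ge0// ltW.
have cE : `|c| = (complex.Re `|c|)%:C by rewrite rc_ge0// ltW.
have d0 : 0 < complex.Re e * complex.Re `|c|.
  by rewrite mulr_gt0// -ltcR -?eE -?cE.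
have := translate_near_uniform y0 cu d0; apply: filterS => y hy.
rewrite -(ler_pM2r cp) -normrM mulrBl !chiE -cexpB; [|exact: bmM..].
rewrite cE eE -rcM; apply: norm_cexp_le => [|x].
  by apply: bmB; exact: bmM.
rewrite -mulrBr normrM chi1 mul1r -rcB rc_norm lecR.
by rewrite distrC; exact: hy.
Qed.

Lemma minimal_idempotent_character (P : borel A -> R[i]) :
  minimal_idempotent P -> exists chi : dual A, P = fun x => P 0 * chi x.
Proof.
move=> mP; have mult := minimal_idempotent_mult mP.
have [[bP sP PP P0] _] := mP.
pose chi : borel A -> R[i] := fun x => (P 0)^-1 * P x.
have bchi : bm chi by exact: bmZ.
have chiD (x y : A) : chi (x + y) = chi x * chi y.
  rewrite /chi mulrACA -mult.
  by field.
have chi0 : chi 0 = 1 by rewrite /chi mulVf.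
have chi_le x : `|chi x| <= 1.
  rewrite /chi normrM normfV mulrC ler_pdivrMr ?normr_gt0// mul1r.
  rewrite [leRHS]ger0_norm; last by rewrite (idempotent0 bP sP PP) sqn_ge0.
  exact: idempotent_norm_le.
have chi1 x : `|chi x| = 1.
  apply/eqP; rewrite eq_le chi_le/=.
  have : `|chi x| * `|chi (- (x : A))| = 1.
    by rewrite -normrM -chiD subrr chi0 normr1.
  move=> <-; rewrite -[leRHS]mulr1 ler_wpM2l//.
exists (Character chiD chi1 (measurable_character_continuous bchi chiD chi1)).
by apply/funext => x; rewrite /= /chi mulrA divff// mul1r.
Qed.

Lemma char0 (chi : dual A) : chi 0 = 1.
Proof.
have := char_add chi 0 0; rewrite addr0 => /(congr1 (fun z => z / chi 0)).
by rewrite divff ?char_neq0// mulfK ?char_neq0.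
Qed.

Lemma charN (chi : dual A) (x : A) : chi (- x) = (chi x)^*.
Proof.
have h : chi (- x) * chi x = 1 by rewrite -char_add addNr char0.
rewrite -[LHS]mulr1 -(expr1n _ 2) -(char_norm chi x) normCK mulrA h mul1r//.
Qed.

Lemma bm_char_mul u (chi : dual A) : bm u -> bm (fun x => u x * (chi x)^*).
Proof. by move=> bu; apply: bmM => //; apply: bmJ; exact: bm_char. Qed.

Lemma convol_char u (chi : dual A) : bm u ->
  convol u (chi : borel A -> R[i]) = fun x => fourier u chi * chi x.
Proof.
move=> bu; apply/funext => x.
rewrite convolC//; last exact: bm_char.
rewrite /convol /fourier mulrC -cexpZ; last exact: bm_char_mul.
by apply: eq_cexp => y; rewrite char_add charN; ring.
Qed.

Lemma fourier_star u (chi : dual A) : bm u ->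
  fourier (star u) chi = (fourier u chi)^*.
Proof.
move=> bu; rewrite /fourier -cexpJ; last exact: bm_char_mul.
rewrite -[LHS]haar_opp; last by apply: bm_char_mul; exact: bm_star.
by apply: eq_cexp => x; rewrite /star opprK charN conjCK conjcM conjCK.
Qed.

(* With [K = h * h~], [sqn K = <h, K * h>] and [sqn (K * h) = <h, (K * K) * h>];
   Cauchy-Schwarz applies to each. *)
Lemma sqn_convol_square_ge h : bm h -> (forall x, `|h x| <= 1) ->
  sq (convol h (star h)) ^+ 4 <=
  sq (convol (convol h (star h)) (convol h (star h))).
Proof.
move=> bh h1; set K := convol h (star h).
have bsh : bm (star h) by exact: bm_star.
have bK : bm K by exact: bm_conv.
have sK : star K = K by rewrite star_conv// starK convolC.
have sh : sq h <= 1 by rewrite -(expr1n _ 2); exact: sqn_le.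
have s0 u := sqn_ge0 (haar A) u.
pose w := convol K h; have bw : bm w by exact: bm_conv.
pose M := convol K K; have bM : bm M by exact: bm_conv.
have cs v : bm v -> `|E (fun x => h x * (v x)^*)| ^+ 2 <= sq v.
  move=> bv; apply: le_trans (cauchy_schwarz _ bh bv) _.
  by rewrite -[leRHS]mul1r ler_wpM2r.
have e1 : sq K = E (fun x => h x * (w x)^*).
  have Ke : K = convol (star h) h by exact: convolC.
  have := conv_adjoint bsh bh bK; rewrite -Ke starK (convolC bh bK) => <-.
  by [].
have e2 : sq w = E (fun x => h x * (convol M h x)^*).
  have wM : convol K w = convol M h by exact/esym/convolA.
  by have := conv_adjoint bK bh bw; rewrite sK wM => <-.
have l1 : sq K ^+ 2 <= sq w.
  by rewrite -(ger0_norm (s0 K)) {1}e1; exact: cs.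
have l2 : sq w ^+ 2 <= sq M.
  rewrite -(ger0_norm (s0 w)) {1}e2.
  exact: le_trans (cs _ (bm_conv bM bh))
    (le_trans (sqn_conv bM bh) (ler_piMr (s0 M) sh)).
have e4 (z : R[i]) : z ^+ 4 = (z ^+ 2) ^+ 2 by rewrite -exprM.
have nn (z z' : R[i]) : 0 <= z -> 0 <= z' -> z <= z' -> z ^+ 2 <= z' ^+ 2.
  by move=> z0 z'0; exact: lerXn2r.
rewrite e4; exact: le_trans (nn _ _ (exprn_ge0 2 (s0 K)) (s0 w) l1) l2.
Qed.

Theorem fourier_inverse h : bm h -> (forall x, `|h x| <= 1) ->
  sq (convol h (star h)) != 0 ->
  exists chi : dual A, sq (convol h (star h)) ^+ 3 <= `|fourier h chi| ^+ 4.
Proof.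
move=> bh h1; set K := convol h (star h) => K0.
have bsh : bm (star h) by exact: bm_star.
have bK : bm K by exact: bm_conv.
have sK : star K = K by rewrite star_conv// starK convolC.
have Kp : 0 < sq K by rewrite lt_def K0 sqn_ge0.
have key := sqn_convol_square_ge bh h1; rewrite -/K in key.
have Mp : 0 < sq (convol K K) by apply: lt_le_trans key; rewrite exprn_gt0.
have bM : bm (convol K K) by exact: bm_conv.
have [lam [P [lam0 iP MP lamK]]] := convpow_idempotent bK sK Mp.
have [P0 [mP0 PP0]] := exists_minimal_idempotent iP.
have [[bP0 _ _ P00] _] := mP0; have [bP _ _ _] := iP.
have MP0 : convol (convol K K) P0 = fun x => lam%:C * P0 x.
  by rewrite -{1}PP0 -(convolA bM bP bP0) MP (convolZl _ bP0 bP) PP0.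
have [chi chiE] := minimal_idempotent_character mP0.
exists chi.
have bchi := bm_char chi.
have Kchi : convol K chi = fun x => `|fourier h chi| ^+ 2 * chi x.
  have e1 : convol K chi = convol h (convol (star h) chi) := convolA bh bsh bchi.
  rewrite e1 (convol_char chi bsh) (convolZr _ bh bchi) (convol_char chi bh).
  rewrite (fourier_star chi bh).
  by apply/funext => x; rewrite mulrA normCK; congr (_ * _); rewrite mulrC.
have Mchi : convol (convol K K) chi = fun x => `|fourier h chi| ^+ 4 * chi x.
  rewrite (convolA bK bK bchi) Kchi (convolZr _ bK bchi) Kchi.
  by apply/funext => x; rewrite mulrA -exprD.
have lamE : lam%:C = `|fourier h chi| ^+ 4.
  have MP0' : convol (convol K K) P0 =
      fun x => P0 0 * (`|fourier h chi| ^+ 4 * chi x).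
    by rewrite {1}chiE (convolZr _ bM bchi) Mchi.
  have := congr1 (fun f => f 0) MP0; rewrite MP0' char0 mulr1 mulrC.
  by move/(mulIf P00).
rewrite -lamE -(ler_pM2r Kp) -exprSr.
exact: le_trans key lamK.
Qed.

End inverse_theorem.

(** * The U2 norm and true complexity *)

Section U2norm_facts.
Context (R : realType) (A : compactAbelianGroup R).
Local Notation E := (cexpectation (haar A)).
Local Notation sq := (sqn (haar A)).

Lemma U2norm_convol (f : A -> R[i]) : bm (f : borel A -> R[i]) ->
  U2norm f = complex.Re (sq (convol f (star f))) `^ 4^-1.
Proof.
move=> bf; rewrite /U2norm; congr (complex.Re _ `^ _).
pose T := borel A.
pose F (t : T * (T * T)) : R[i] :=
  f t.1 * (f ((t.1 : A) + t.2.1))^* * (f ((t.1 : A) + t.2.2))^* *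
    f ((t.1 : A) + t.2.1 + t.2.2).
have m1 : measurable_fun setT (fun t : T * (T * T) => t.1) by exact: measurable_fst.
have m2 : measurable_fun setT (fun t : T * (T * T) => t.2.1).
  by apply: (measurableT_comp measurable_fst); exact: measurable_snd.
have m3 : measurable_fun setT (fun t : T * (T * T) => t.2.2).
  by apply: (measurableT_comp measurable_snd); exact: measurable_snd.
have bF : bm F.
  apply: bmM; last by apply: (bm_comp _ bf); apply: measurable_add2 => //; exact: measurable_add2.
  apply: bmM; last by apply: bmJ; apply: (bm_comp _ bf); exact: measurable_add2.
  apply: bmM; last by apply: bmJ; apply: (bm_comp _ bf); exact: measurable_add2.
  exact: (bm_comp m1 bf).
transitivity (cexpectation (haar A \x (haar A \x haar A))%E F).
  by apply: eq_cexp => -[x [a b]].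
pose K : T -> R[i] := convol f (star f).
have bsf : bm (star f : T -> R[i]) by exact: bm_star.
have bK : bm K by exact: bm_conv.
have KE (a : A) : K a = E (fun y : T => f (a + y) * (f y)^*).
  rewrite -[RHS]haar_opp; last by apply: bmM; [exact: bm_shift|exact: bmJ].
  by [].
rewrite cexp_prod1//.
pose G (p : T * T) : R[i] := f p.1 * (f ((p.1 : A) + p.2))^* * K p.2.
have bG : bm G.
  apply: bmM; last by apply: (bm_comp _ bK); exact: measurable_snd.
  apply: bmM; first by apply: (bm_comp _ bf); exact: measurable_fst.
  by apply: bmJ; apply: (bm_comp _ bf); exact: measurable_addb.
transitivity (E (fun x => E (fun a => G (x, a)))).
  apply: eq_cexp => x; rewrite cexp_prod1; last exact: bm_section1.
  apply: eq_cexp => a; rewrite /F /G /= KE.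
  have bb : bm (fun y : T => f ((a : A) + y) * (f y)^*).
    by apply: bmM; [exact: bm_shift|exact: bmJ].
  rewrite -(haar_shiftl (x : A) bb) -cexpZ; last exact: (bm_shift (x : A) bb).
  apply: eq_cexp => b; rewrite addrA [(a : A) + x]addrC; ring.
rewrite cexp_swap//; apply: eq_cexp => a; rewrite /G /=.
rewrite cexpZr; last by apply: bmM => //; apply: bmJ; exact: bm_shiftr.
rewrite mulrC -/K; congr (_ * _).
rewrite KE -cexpJ; last by apply: bmM; [exact: bm_shift|exact: bmJ].
by apply: eq_cexp => x; rewrite conjcM conjCK mulrC addrC.
Qed.

Lemma fourier_small_U2norm (h : A -> R[i]) (d : R) :
  bm (h : borel A -> R[i]) -> (forall x, `|h x| <= 1) -> 0 < d ->
  (forall chi : dual A, `|fourier h chi| <= (d ^+ 3)%:C) -> U2norm h <= d.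
Proof.
move=> bh h1 d0 hd; rewrite U2norm_convol//.
set s := sq _; have s0 : 0 <= s by exact: sqn_ge0.
have Re0 : 0 <= complex.Re s by rewrite -ler0c rc_ge0.
have sd : complex.Re s <= d ^+ 4.
  have [->|sn0] := eqVneq s 0; first by rewrite exprn_ge0// ltW.
  have [chi] := fourier_inverse bh h1 sn0; rewrite -/s => schi.
  have nn m (z z' : R[i]) : 0 <= z -> z <= z' -> z ^+ m <= z' ^+ m.
    by move=> z0 zz'; apply: lerXn2r => //; rewrite nnegrE// (le_trans z0).
  have := le_trans schi (nn 4 _ _ (normr_ge0 _) (hd chi)).
  rewrite -(rc_ge0 s0) -!rcX lecR -exprM -[(3 * 4)%N]/(4 * 3)%N exprM.
  by rewrite ler_pXn2r// nnegrE ?exprn_ge0// ltW.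
rewrite (@le_trans _ _ ((d ^+ 4) `^ 4^-1))//.
  by apply: ge0_ler_powR; rewrite ?nnegrE ?exprn_ge0 ?invr_ge0 ?(ltW d0).
by rewrite -powR_mulrn ?(ltW d0)// -powRrM mulfV// powRr1// ltW.
Qed.

End U2norm_facts.

Section densities_facts.
Context (R : realType) (k n : nat) (L : 'M[int]_(k, n)).
Implicit Types A B : compactAbelianGroup R.

Lemma measurable_linear_form A (i : 'I_k) :
  measurable_fun setT (fun t : n.-tuple (borel A) => linear_form L i t : borel A).
Proof.
rewrite /linear_form.
apply: (@measurable_sum_borel R A _ _ _ (index_enum 'I_n)
  (fun j (t : n.-tuple (borel A)) => (tnth t j : A) *~ L i j)) => j.
by apply: (@measurable_mulrz R A); exact: measurable_tnth.
Qed.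

Lemma bm_densities A (f : 'I_k -> A -> R[i]) :
  (forall i, bm (f i : borel A -> R[i])) ->
  bm (fun t : n.-tuple (borel A) => \prod_(i < k) f i (linear_form L i t)).
Proof.
move=> bf; apply: bm_prod => i.
exact: (bm_comp (@measurable_linear_form A i) (bf i)).
Qed.

Lemma densities_epi A B (alpha : {additive A -> B}) (f : 'I_k -> B -> R[i]) :
  epimorphism alpha -> (forall i, bm (f i : borel B -> R[i])) ->
  densities L (fun i => f i \o alpha) = densities L f.
Proof.
move=> [ac asurj] bf; rewrite /densities -(@haar_power_epi _ A B alpha)//.
- apply: eq_cexp => t; apply: eq_bigr => i _ /=; congr (f i _).
  rewrite /linear_form raddf_sum; apply: eq_bigr => j _.
  by rewrite raddfMz tnth_map.
- exact: raddfD.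
- exact: bm_densities.
Qed.

Lemma densitiesZ A (c : R[i]) (f : 'I_k -> A -> R[i]) :
  (forall i, bm (f i : borel A -> R[i])) ->
  densities L (fun i x => c * f i x) = c ^+ k * densities L f.
Proof.
move=> bf; rewrite /densities -cexpZ; last exact: bm_densities.
by apply: eq_cexp => t; rewrite big_split/= prodr_const card_ord.
Qed.

Definition hybrid A (f g : A -> R[i]) m (i : 'I_k) : A -> R[i] :=
  if (i < m)%N then f else g.

Lemma densities_hybridB A (f g : A -> R[i]) (m : 'I_k) :
  bm (f : borel A -> R[i]) -> bm (g : borel A -> R[i]) ->
  densities L (hybrid f g m.+1) - densities L (hybrid f g m) =
  densities L (fun i => if i == m then (fun x => f x - g x) else hybrid f g m i).
Proof.
move=> bf bg; have bh m' i : bm (hybrid f g m' i : borel A -> R[i]).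
  by rewrite /hybrid; case: ifP.
rewrite /densities -cexpB; [|exact: bm_densities..].
apply: eq_cexp => t.
rewrite (bigD1 m)//= [X in _ - X](bigD1 m)//= [RHS](bigD1 m)//= eqxx.
rewrite {1}/hybrid ltnSn {2}/hybrid ltnn.
rewrite [X in _ * X - _](_ : _ = \prod_(i < k | i != m) hybrid f g m i (linear_form L i t)).
  rewrite [X in _ = _ * X](_ : _ = \prod_(i < k | i != m) hybrid f g m i (linear_form L i t)).
    by rewrite mulrBl.
  by apply: eq_bigr => i /negbTE ->.
apply: eq_bigr => i im; rewrite /hybrid ltnS leq_eqVlt.
by rewrite (_ : (i == m :> nat) = false)//; apply/negbTE.
Qed.

Section true_complexity.
Variable F : compactAbelianGroup R -> Prop.
Hypothesis LF : true_complexity_le1 L F.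

Lemma density_close (a eps : R) : 0 < a -> 0 < eps ->
  exists2 e1 : R, 0 < e1 & forall A (f g : A -> R[i]), F A ->
    bm (f : borel A -> R[i]) -> bm (g : borel A -> R[i]) ->
    (forall x, `|f x| <= a%:C) -> (forall x, `|g x| <= a%:C) ->
    (forall chi : dual A, `|fourier f chi - fourier g chi| <= e1%:C) ->
    `|density L f - density L g| <= eps%:C.
Proof.
move=> a0 e0; pose s := 2 * a; have s0 : 0 < s by rewrite mulr_gt0.
pose eps' := eps / (s ^+ k * k.+1%:R).
have sk0 : 0 < s ^+ k by rewrite exprn_gt0.
have e'0 : 0 < eps' by rewrite divr_gt0// mulr_gt0.
have [d d0 hd] := LF e'0.
exists (s * d ^+ 3); first by rewrite mulr_gt0// exprn_gt0.
move=> A f g FA bf bg fa ga fg.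
have sC : (s%:C : R[i]) != 0 by rewrite (_ : 0 = 0%:C)// (inj_eq (@complexI R)) gt_eqF.
have step (m : 'I_k) :
    `|densities L (hybrid f g m.+1) - densities L (hybrid f g m)| <= (s ^+ k * eps')%:C.
  rewrite densities_hybridB//; set h := fun i => _.
  have bfg : bm (fun x : borel A => f x - g x) by exact: bmB.
  have bh i : bm (h i : borel A -> R[i]).
    by rewrite /h /hybrid; case: ifP => // _; case: ifP.
  have hs i x : `|h i x| <= s%:C.
    have as_ : a%:C <= s%:C :> R[i] by rewrite lecR /s; lra.
    rewrite /h /hybrid; case: ifP => _.
      rewrite (le_trans (ler_normB _ _))// (_ : s = a + a) ?rcD ?lerD//.
      by rewrite /s; ring.
    by case: ifP => _; rewrite (le_trans _ as_).
  pose h' i x := (s%:C)^-1 * h i x.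
  have bh' i : bm (h' i : borel A -> R[i]) by exact: bmZ.
  have h'1 i x : `|h' i x| <= 1.
    rewrite /h' normrM normfV rc_norm (gtr0_norm s0) mulrC ler_pdivrMr ?mul1r//.
    by rewrite (_ : 0 = 0%:C)// ltcR.
  have -> : densities L h = (s%:C) ^+ k * densities L h'.
    rewrite -densitiesZ//; congr (densities L _); apply/funext => i.
    by apply/funext => x; rewrite /h' mulrA divff// mul1r.
  rewrite normrM -rcX rc_norm (gtr0_norm sk0) rcM ler_wpM2l ?ler0c ?(ltW sk0)//.
  rewrite normC_normc lecR; apply: hd => //.
  - by move=> i; exact: (bh' i).1.
  - by move=> i x; have := h'1 i x; rewrite normC_normc -[1]/(1%:C) lecR.
  exists m; apply: fourier_small_U2norm => // chi.
  rewrite /h' /h eqxx /fourier.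
  have e1 : cexpectation (haar A) (fun x : borel A => (s%:C)^-1 * (f x - g x) * (chi x)^*)
      = (s%:C)^-1 * (fourier f chi - fourier g chi).
    rewrite -cexpB; [|exact: bm_char_mul..].
    rewrite -cexpZ; last by apply: bmB; exact: bm_char_mul.
    by apply: eq_cexp => x; ring.
  rewrite e1 normrM normfV rc_norm (gtr0_norm s0) mulrC ler_pdivrMr; last first.
    by rewrite (_ : 0 = 0%:C)// ltcR.
  by rewrite mulrC -rcM.
rewrite /density.
have -> : densities L (fun=> f) = densities L (hybrid f g k).
  by congr (densities L _); apply/funext => i; rewrite /hybrid ltn_ord.
have -> : densities L (fun=> g) = densities L (hybrid f g 0).
  by congr (densities L _); apply/funext => i; rewrite /hybrid.
rewrite -(telescope_sumr (fun m => densities L (hybrid f g m)) (leq0n k)) big_mkord.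
rewrite (le_trans (ler_norm_sum _ _ _))//.
rewrite (le_trans (ler_sum _ (fun m _ => step m)))// sumr_const card_ord.
rewrite -[_ *+ k]mulr_natl -rc_nat -rcM lecR.
have epsE : k.+1%:R * (s ^+ k * eps') = eps.
  by rewrite mulrA /eps' mulrC [k.+1%:R * _]mulrC divfK// mulf_neq0 ?gt_eqF.
rewrite -[leRHS]epsE; apply: ler_wpM2r; last by rewrite ler_nat.
by rewrite mulr_ge0 ?ltW.
Qed.

Lemma null_linear_form A (i : 'I_k) (N : set (borel A)) : F A ->
  measurable N -> haar A N = 0%E ->
  power_probability (haar A) n [set t | N (linear_form L i t)] = 0%E.
Proof.
move=> FA mN N0.
have bN : bm (fun x : borel A => (\1_N x : R)%:C) by exact: bm_indic.
have EN : cexpectation (haar A) (fun x : borel A => (\1_N x : R)%:C) = 0.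
  apply: complex_ext => /=; last by rewrite Rintegral_cst// mul0r.
  by rewrite /Rintegral integral_indic// setIT [X in fine X]N0.
have four0 (chi : dual A) : fourier (fun x : A => (\1_N x : R)%:C) chi = 0.
  have bc := bm_char_mul chi bN.
  have s0 : sqn (haar A) (fun x : borel A => (\1_N x : R)%:C * (chi x)^*) = 0.
    rewrite -[RHS]EN; apply: eq_cexp => x; rewrite conjcM conjCK rcJ mulrACA.
    rewrite [X in _ * X]mulrC -normCK char_norm expr1n mulr1 -rcM.
    by rewrite indicE; case: (_ \in _); rewrite ?mulr1 ?mulr0.
  have := norm_cexp_sqn (haar A) bc; rewrite s0 => h.
  by apply/eqP; rewrite -normr_le0 -(@ler_pXn2r _ 2)// ?nnegrE// expr0n.
pose f (j : 'I_k) : A -> R[i] := if j == i then (fun x : A => (\1_N x : R)%:C) else fun=> 1.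
have bf j : bm (f j : borel A -> R[i]).
  by rewrite /f; case: ifP => // _; exact: bm_cst.
have f1 j x : `|f j x| <= 1.
  rewrite /f; case: ifP => _; last by rewrite normr1.
  rewrite rc_norm -[1]/(1%:C) lecR indicE.
  by case: (_ \in _); rewrite ?normr1 ?normr0.
have tE : densities L f = cexpectation (power_probability (haar A) n)
    (fun t => (\1_[set t | N (linear_form L i t)] t : R)%:C).
  apply: eq_cexp => t; rewrite (bigD1 i)//= big1 ?mulr1.
    by rewrite /f eqxx !indicE; congr (_%:R%:C); rewrite !inE.
  by move=> j /negbTE ji; rewrite /f ji.
have t0 : normc (densities L f) = 0.
  apply/eqP; rewrite eq_le; apply/andP; split; last by rewrite -ler0c -normC_normc.
  apply/ler_addgt0Pr => e e0; rewrite add0r; have [d d0 hd] := LF e0.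
  apply: hd => //.
  - by move=> j; exact: (bf j).1.
  - by move=> j x; have := f1 j x; rewrite normC_normc -[1]/(1%:C) lecR.
  exists i; apply: fourier_small_U2norm => // chi.
  rewrite {1}/f eqxx four0 normr0 ler0c exprn_ge0// ltW//.
have mS : measurable [set t | N (linear_form L i t)].
  by have := @measurable_linear_form A i measurableT _ mN; rewrite setTI.
have := eq0_normc t0; rewrite tE => /(congr1 (@complex.Re R)).
rewrite [LHS]/= /Rintegral integral_indic// setIT => P0.
rewrite -[LHS]fineK ?P0//; exact: fin_num_measure.
Qed.

Lemma densities_ae A (f g : A -> R[i]) : F A ->
  cmeasurable (f : borel A -> R[i]) -> cmeasurable (g : borel A -> R[i]) ->
  {ae haar A, forall x, f x = g x} -> density L f = density L g.
Proof.
move=> FA mf mg [N [mN N0 fgN]].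
have mL (u : A -> R[i]) : cmeasurable (u : borel A -> R[i]) ->
    cmeasurable (fun t : n.-tuple (borel A) => \prod_(i < k) u (linear_form L i t)).
  move=> [u1 u2]; apply: cmeasurable_prod => i; split.
    exact: (measurableT_comp u1 (@measurable_linear_form A i)).
  exact: (measurableT_comp u2 (@measurable_linear_form A i)).
apply: ae_eq_cexp; [exact: mL|exact: mL|].
suff : {ae power_probability (haar A) n, forall t (i : 'I_k),
    f (linear_form L i t) = g (linear_form L i t)}.
  by apply: filterS => t h; apply: eq_bigr => i _; exact: h.
apply: filter_forall => i; exists [set t | N (linear_form L i t)]; split.
- by have := @measurable_linear_form A i measurableT _ mN; rewrite setTI.
- exact: null_linear_form.
- by move=> t /= h; exact: fgN.
Qed.

End true_complexity.

End densities_facts.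


Section truncation.
Context (R : realType) (A : compactAbelianGroup R) (a : R).
Hypothesis a0 : 0 < a.
Implicit Types f : A -> R[i].

Definition truncate f : A -> R[i] :=
  fun x => f x * (\1_[set y : A | normc (f y) <= a] x : R)%:C.

Lemma truncate_id f x : normc (f x) <= a -> truncate f x = f x.
Proof. by move=> fa; rewrite /truncate indicE mem_set// mulr1. Qed.

Lemma truncate_le f x : `|truncate f x| <= a%:C.
Proof.
have [fa|fa] := leP (normc (f x)) a.
  by rewrite truncate_id// normC_normc lecR.
rewrite /truncate indicE memNset ?mulr0 ?normr0 ?ler0c ?ltW//=.
by apply/negP; rewrite -ltNge.
Qed.

Lemma bm_truncate f : cmeasurable (f : borel A -> R[i]) ->
  bm (truncate f : borel A -> R[i]).
Proof.
move=> mf; split; last by exists a%:C => x; exact: truncate_le.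
apply: cmeasurableM => //.
apply: (bm_indic R (_ : measurable ([set y | normc (f y) <= a] : set (borel A)))).1.
have [f1 f2] := mf.
pose h (x : borel A) := complex.Re (f x) ^+ 2 + complex.Im (f x) ^+ 2.
have mh : measurable_fun setT h.
  by apply: measurable_funD; exact: measurable_funX.
rewrite (_ : [set y | _] = h @^-1` `]-oo, a ^+ 2]).
  by rewrite -[X in measurable X]setTI; apply: mh.
have sqE z : normc z ^+ 2 = complex.Re z ^+ 2 + complex.Im z ^+ 2 :> R.
  by case: z => p q; rewrite /= sqr_sqrtr// addr_ge0 ?sqr_ge0.
have n0 z : 0 <= normc z :> R by rewrite -ler0c -normC_normc.
have e x : (normc (f x) <= a) = (h x <= a ^+ 2).
  by rewrite /h -sqE ler_pXn2r// nnegrE// ltW.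
by apply/seteqP; split => x; rewrite /= in_itv/= e.
Qed.

Lemma truncate_ae f : Linfty_ball a f ->
  {ae haar A, forall x : borel A, f x = truncate f x}.
Proof.
move=> [_ [N [mN N0 fN]]]; exists N; split => // x nx; apply: fN => fx.
by apply: nx => /=; rewrite truncate_id.
Qed.

End truncation.

Section isomorphic_functions.
Context (R : realType) (k n : nat) (L : 'M[int]_(k, n)).
Variables (F : compactAbelianGroup R -> Prop) (a : R).
Hypotheses (LF : true_complexity_le1 L F) (a0 : 0 < a).

Lemma density_factor (A B : compactAbelianGroup R) (f : A -> R[i])
    (g : B -> R[i]) (alpha : {additive A -> B}) :
  F A -> Linfty_ball a f -> cmeasurable (g : borel B -> R[i]) ->
  epimorphism alpha -> {ae haar A, forall x : borel A, g (alpha x) = f x} ->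
  density L f = density L (truncate a g).
Proof.
move=> FA [mf fa] mg ea gf.
have bt := bm_truncate a0 mg.
rewrite -[RHS](densities_epi L ea (fun=> bt)).
apply: (densities_ae LF FA) => //.
  have [ac _] := ea.
  exact: (bm_comp (continuous_measurable ac) bt).1.
have [N [mN N0 gN]] := gf; have [M [mM M0 fM]] := fa.
exists (N `|` M); split; first exact: measurableU.
  by rewrite null_set_setU.
move=> x nx; have [Nx|nNx] := pselect (N x); first by left.
right; apply: fM => fx; apply: nx; have gx : g (alpha x) = f x.
  by apply: contrapT => /gN.
by rewrite /= truncate_id gx.
Qed.

Lemma isomorphic_density (A B : compactAbelianGroup R) (f : A -> R[i])
    (g : B -> R[i]) :
  F A -> F B -> Linfty_ball a f -> Linfty_ball a g ->
  isomorphic f g -> density L f = density L g.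
Proof.
move=> FA FB fa ga [C [h [al [be [[mh _] eal ebe hf hg]]]]].
by rewrite (density_factor FA fa mh eal hf) (density_factor FB ga mh ebe hg).
Qed.

End isomorphic_functions.

Definition adual (R : realType) (A : compactAbelianGroup R) := dual A.

Section additive_dual.
Context (R : realType) (A : compactAbelianGroup R).

HB.instance Definition _ := gen_eqMixin (adual A).
HB.instance Definition _ := gen_choiceMixin (adual A).

Let adual_addA : associative (@dual_mul R A).
Proof. exact: (@mulgA (dual A)). Qed.
Let adual_addC : commutative (@dual_mul R A).
Proof.
move=> f g; apply: dual_ext => x.
exact: etrans (dual_mulE f g x) (etrans (mulrC _ _) (esym (dual_mulE g f x))).
Qed.
Let adual_add0 : left_id (dual_one A) (@dual_mul R A).
Proof. exact: (@mul1g (dual A)). Qed.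
Let adual_addN : left_inverse (dual_one A) (@dual_inv R A) (@dual_mul R A).
Proof. exact: (@mulVg (dual A)). Qed.

HB.instance Definition _ := GRing.isZmodule.Build (adual A)
  adual_addA adual_addC adual_add0 adual_addN.

Lemma adualD (chi psi : adual A) (x : A) :
  (chi + psi : adual A) x = chi x * psi x.
Proof. exact: dual_mulE. Qed.

Lemma adual0 (x : A) : (0 : adual A) x = 1.
Proof. exact: dual_oneE. Qed.

Lemma adualN (chi : adual A) (x : A) : (- chi : adual A) x = (chi x)^*.
Proof.
rewrite -[LHS]/(dual_inv chi x) dual_invE -[LHS]mul1r -(expr1n _ 2).
by rewrite -(char_norm chi x) normCK mulrC mulKf// char_neq0.
Qed.

Lemma adual_sum I (r : seq I) (p : pred I) (f : I -> adual A) (x : A) :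
  (\sum_(i <- r | p i) f i : adual A) x = \prod_(i <- r | p i) f i x.
Proof.
elim: r => [|i r IH]; first by rewrite !big_nil adual0.
by rewrite !big_cons; case: (p i); rewrite ?adualD IH.
Qed.

Lemma int_expgE (chi : dual A) z : int_expg chi z = (chi : adual A) *~ z.
Proof.
have expE m : (chi ^+ m)%g = (chi : adual A) *+ m :> dual A.
  by elim: m => [|m IH]//; rewrite expgS mulrS IH.
by case: z => m; rewrite /= expE.
Qed.

Lemma prodgE I (r : seq I) (f : I -> dual A) :
  (\prod_(i <- r) f i)%g = (\sum_(i <- r) (f i : adual A)) :> dual A.
Proof. by elim: r => [|i r IH]; rewrite !(big_nil, big_cons)// IH. Qed.

Lemma char_mulrz (chi : adual A) (x : A) z : chi (x *~ z) = (chi *~ z : adual A) x.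
Proof.
have mulrnE m : chi (x *+ m) = (chi *+ m : adual A) x.
  elim: m => [|m IH]; first by rewrite char0 adual0.
  by rewrite !mulrS char_add adualD IH.
case: z => m; first exact: mulrnE.
by rewrite !NegzE !mulrNz charN adualN [x *~ _]/(x *+ m.+1) mulrnE.
Qed.

Lemma char_sum (chi : adual A) I (r : seq I) (f : I -> A) :
  chi (\sum_(i <- r) f i) = \prod_(i <- r) chi (f i).
Proof.
by elim: r => [|i r IH]; rewrite !(big_nil, big_cons) ?char0// char_add IH.
Qed.

Lemma cexp_char (chi : adual A) :
  cexpectation (haar A) (chi : borel A -> R[i]) = (chi == 0)%:R.
Proof.
have [->|chi0] := eqVneq chi 0.
  by rewrite -[RHS](cexp_cst (haar A)); apply: eq_cexp => x; rewrite adual0.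
have [y chiy] : exists y, chi y <> 1.
  apply/existsNP => chi1; move/eqP: chi0; apply.
  by apply: dual_ext => x; rewrite chi1 adual0.
have bchi := bm_char chi.
have := haar_shiftl y bchi.
under eq_cexp do rewrite char_add.
rewrite cexpZ// => /eqP; rewrite -subr_eq0 -{2}[cexpectation _ _]mul1r -mulrBl.
by rewrite mulf_eq0 subr_eq0 => /orP[/eqP//|/eqP].
Qed.

End additive_dual.

(** * Fejer kernels and Folner sets *)

Section differences.
Variables (V : zmodType) (I : finType) (b : I -> V).
Hypothesis injb : injective b.

Lemma sum_diff_eq0 (K : pzSemiRingType) :
  \sum_(p : I * I) (b p.1 - b p.2 == 0)%:R = #|I|%:R :> K.
Proof.
rewrite -(pair_big predT predT (fun s t => (b s - b t == 0)%:R))/=.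
rewrite -sum1_card natr_sum; apply: eq_bigr => s _.
rewrite (bigD1 s)//= subrr eqxx big1 ?addr0// => t ts.
by rewrite subr_eq0 (inj_eq injb) eq_sym (negbTE ts).
Qed.

Lemma card_diff_le (v : V) : (#|[pred p : I * I | (b p.1 - b p.2 == v)%R]| <= #|I|)%N.
Proof.
rewrite -(@card_in_imset _ _ snd); first exact: max_card.
move=> [s t] [s' t'] /eqP /= h1 /eqP /= h2 et; rewrite -et in h2 *.
by rewrite (injb (addIr _ (etrans h1 (esym h2)))).
Qed.

Lemma card_diff_ge (v : V) (S : {pred I}) :
  (forall t, t \in S -> exists s, b s = v + b t) ->
  (#|S| <= #|[pred p : I * I | (b p.1 - b p.2 == v)%R]|)%N.
Proof.
move=> hS.
have /choice[u hu] : forall t, exists s, t \in S -> b s = v + b t.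
  by move=> t; case: (boolP (t \in S)) => [/hS[s] ?|_]; [exists s|exists t].
rewrite -(@card_in_imset _ _ (fun t => (u t, t)) S); last by move=> ? ? _ _ [].
apply: subset_leq_card; apply/fintype.subsetP => _ /imsetP[t tS ->].
by rewrite inE/= hu// addrK.
Qed.

End differences.

Section smoothing.
Context (R : realType) (A : compactAbelianGroup R) (I : finType).
Variable beta : I -> adual A.
Local Notation E := (cexpectation (haar A)).

Definition diff_char (p : I * I) : adual A := beta p.1 - beta p.2.

(* Convolution with the Fejer kernel [|\sum_s beta s|^2 / #|I|]. *)
Definition smooth (f : A -> R[i]) : A -> R[i] := fun x =>
  #|I|%:R^-1 * \sum_p fourier f (diff_char p) * diff_char p x.

Definition fejer_weight (psi : adual A) : nat := #|[pred p | diff_char p == psi]|.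

Let D (x : A) : R[i] := \sum_s beta s x.

Let bD : bm (D : borel A -> R[i]).
Proof. by apply: bm_sum => s; exact: bm_char. Qed.

Let DJ x : D x * (D x)^* = \sum_p diff_char p x.
Proof.
rewrite /D rmorph_sum/= big_distrlr/= pair_big/=; apply: eq_bigr => p _.
by rewrite /diff_char adualD adualN.
Qed.

Lemma smoothE f (x : A) : bm (f : borel A -> R[i]) ->
  smooth f x = #|I|%:R^-1 * E (fun y : borel A => f (x - y) * (D y * (D y)^*)).
Proof.
move=> bf; congr (_ * _).
under eq_cexp do rewrite DJ mulr_sumr.
rewrite cexp_sum.
  apply: eq_bigr => p _; have /(congr1 (fun u => u x)) := convol_char (diff_char p) bf.
  by move=> /= <-.
by move=> p; apply: bmM; [exact: bm_reflect|exact: bm_char].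
Qed.

Lemma bm_smooth f : bm (smooth f : borel A -> R[i]).
Proof. by apply: bmZ; apply: bm_sum => p; apply: bmZ; exact: bm_char. Qed.

Lemma fourier_char (chi psi : adual A) :
  fourier (chi : A -> R[i]) psi = (chi == psi)%:R.
Proof.
rewrite -subr_eq0 -cexp_char; apply: eq_cexp => x.
by rewrite adualD adualN.
Qed.

Lemma fourier_smooth f (psi : adual A) :
  fourier (smooth f) psi = fourier f psi * ((fejer_weight psi)%:R / #|I|%:R).
Proof.
have -> : fourier (smooth f) psi = #|I|%:R^-1 *
    \sum_p fourier f (diff_char p) * fourier (diff_char p : A -> R[i]) psi.
  have bp p : bm (fun x : borel A => fourier f (diff_char p) *
      (diff_char p x * (psi x)^*)).
    by apply: bmZ; apply: bm_char_mul; exact: bm_char.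
  rewrite {1}/fourier.
  transitivity (E (fun x : borel A => #|I|%:R^-1 *
      \sum_p fourier f (diff_char p) * (diff_char p x * (psi x)^*))).
    apply: eq_cexp => x; rewrite /smooth -mulrA mulr_suml; congr (_ * _).
    by apply: eq_bigr => p _; rewrite mulrA.
  rewrite cexpZ; last exact: bm_sum.
  rewrite cexp_sum//; congr (_ * _); apply: eq_bigr => p _.
  by rewrite cexpZ//; apply: bm_char_mul; exact: bm_char.
rewrite [RHS]mulrA [RHS]mulrC; congr (_ * _).
rewrite /fejer_weight -sum1_card natr_sum mulr_sumr [RHS]big_mkcond/=.
apply: eq_bigr => p _; rewrite fourier_char inE; case: eqP => [->//|_].
by rewrite mulr0.
Qed.

Hypothesis injb : injective beta.
Hypothesis I0 : (0 < #|I|)%N.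

Let sqD : sqn (haar A) (D : borel A -> R[i]) = #|I|%:R.
Proof.
rewrite /sqn; under eq_cexp do rewrite DJ.
rewrite cexp_sum; last by move=> p; exact: bm_char.
under eq_bigr do rewrite cexp_char.
exact: sum_diff_eq0 injb _.
Qed.

Let r0 : 0 < #|I|%:R :> R[i].
Proof. by rewrite ltr0n. Qed.

Lemma smooth_le f (a : R) x : 0 <= a -> bm (f : borel A -> R[i]) ->
  (forall x, `|f x| <= a%:C) -> `|smooth f x| <= a%:C.
Proof.
move=> a0 bf fa; rewrite smoothE// normrM ger0_norm ?invr_ge0 ?ler0n//.
rewrite mulrC ler_pdivrMr//.
have ra : 0 <= a%:C * #|I|%:R :> R[i] by rewrite mulr_ge0 ?ler0c ?ler0n.
rewrite -(@ler_pXn2r _ 2)// ?nnegrE//.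
have bfD : bm (fun y : borel A => f (x - y) * D y).
  by apply: bmM => //; exact: bm_reflect.
have := cauchy_schwarz (haar A) bfD bD.
under [X in `|X| ^+ 2 <= _]eq_cexp do rewrite -mulrA.
move=> /le_trans; apply.
have bs : sqn (haar A) (fun y : borel A => f (x - y) * D y) <= a%:C ^+ 2 * #|I|%:R.
  rewrite -sqD -cexpZ; last exact: bm_sq.
  apply: le_cexp; [exact: bm_sq|by apply: bmZ; exact: bm_sq|] => y.
  rewrite conjcM mulrACA ler_wpM2r ?mul_conjC_ge0// -normCK.
  by apply: lerXn2r => //; rewrite nnegrE ?ler0c.
rewrite sqD exprMn [X in _ <= _ * X]expr2 mulrA.
by apply: ler_wpM2r => //; exact: ltW.
Qed.

Lemma density_smooth k n (L : 'M[int]_(k, n)) f :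
  density L (smooth f) = #|I|%:R^-1 ^+ k *
    \sum_(s : {ffun 'I_k -> I * I}) (\prod_i fourier f (diff_char (s i))) *
      [forall j, \sum_i diff_char (s i) *~ L i j == 0]%:R.
Proof.
have -> : smooth f = fun x => #|I|%:R^-1 *
    \sum_p fourier f (diff_char p) * diff_char p x by [].
rewrite /density (densitiesZ L _ (f := fun=> _)); last first.
  by move=> i; apply: bm_sum => p; apply: bmZ; exact: bm_char.
congr (_ * _); rewrite /densities.
under eq_cexp do rewrite bigA_distr_bigA/=.
have bL i p : bm (fun t : n.-tuple (borel A) => fourier f (diff_char p) *
    diff_char p (linear_form L i t)).
  by apply: bmZ; apply: (bm_comp (@measurable_linear_form _ _ _ L A i)); exact: bm_char.
rewrite cexp_sum; last by move=> s; exact: bm_prod.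
apply: eq_bigr => s _.
under eq_cexp do rewrite big_split/=.
rewrite cexpZ; last first.
  by apply: bm_prod => i; apply: (bm_comp (@measurable_linear_form _ _ _ L A i)); exact: bm_char.
congr (_ * _).
pose chi j : adual A := \sum_i diff_char (s i) *~ L i j.
transitivity (cexpectation (power_probability (haar A) n)
    (fun t => \prod_j chi j (tnth t j))).
  apply: eq_cexp => t.
  under eq_bigr do rewrite /linear_form char_sum.
  rewrite exchange_big/=; apply: eq_bigr => j _.
  by rewrite /chi adual_sum; apply: eq_bigr => i _; rewrite char_mulrz.
rewrite (cexp_power_prod (fun j => bm_char (chi j))).
under eq_bigr do rewrite cexp_char.
case: forallP => [h|/forallP]; first by rewrite big1// => j _; rewrite (h j).
by rewrite negb_forall => /existsP[j jn]; rewrite (bigD1 j)//= (negbTE jn) mul0r.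
Qed.

End smoothing.

Lemma polynomial_growth_ratio (R : realType) (m : nat) (b : nat -> nat) (eta : R) :
  (0 < b 1)%N -> (forall N, b N <= N ^ m)%N -> 0 < eta ->
  exists2 N, (0 < N)%N & (b N.+1)%:R <= (1 + eta) * (b N)%:R.
Proof.
move=> b1 bm eta0; apply: contrapT => /forall2NP noN.
have grow N : (1 + eta) ^+ N <= (b N.+1)%:R.
  elim: N => [|N IH]; first by rewrite expr0 ler1n.
  have [//|/negP] := noN N.+1; rewrite -ltNge => /ltW; apply: le_trans.
  by rewrite exprS ler_wpM2l// addr_ge0// ltW.
pose x : R := (m.+2 ^ m)%:R / eta ^+ m.+1.
have x0 : 0 <= x by rewrite divr_ge0// exprn_ge0// ltW.
pose n := (Num.truncn x).+1.
have xn : x < n%:R by rewrite truncnS_gt.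
have n0 : (0 < n)%N by [].
have h1 : (n%:R * eta) ^+ m.+1 <= (1 + eta) ^+ (n * m.+1).
  rewrite exprM lerXn2r ?nnegrE ?mulr_ge0 ?exprn_ge0 ?addr_ge0 ?(ltW eta0)//.
  have bern j : 1 + j%:R * eta <= (1 + eta) ^+ j.
    elim: j => [|j IH]; first by rewrite mul0r addr0 expr0.
    rewrite exprS (le_trans _ (ler_wpM2l _ IH)) ?addr_ge0 ?(ltW eta0)//.
    rewrite -natr1 (_ : _ * (1 + _) = 1 + (j%:R + 1) * eta + eta * (j%:R * eta)); last by ring.
    by rewrite lerDl !mulr_ge0// ltW.
  by rewrite (le_trans _ (bern n))// lerDr.
have h2 : (b (n * m.+1).+1 <= (n * m.+2) ^ m)%N.
  rewrite (leq_trans (bm _))//; case: (posnP m) => [->//|m0].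
  by rewrite leq_exp2r// [(n * m.+2)%N]mulnS addnC -addn1 leq_add2l.
have h3 : (n%:R * eta) ^+ m.+1 <= (n%:R * m.+2%:R) ^+ m :> R.
  rewrite (le_trans h1)// (le_trans (grow _))// -natrM -natrX ler_nat//.
have np : 0 < n%:R ^+ m :> R by rewrite exprn_gt0// ltr0n.
move: h3; rewrite !exprMn [n%:R ^+ m.+1]exprSr -mulrA ler_pM2l//.
rewrite -ler_pdivlMr ?exprn_gt0// -natrX -/x => /le_lt_trans/(_ xn).
by rewrite ltxx.
Qed.

Section words.
Variables (V : zmodType) (m : nat) (chi : 'I_m -> V).

Definition word (z : 'I_m -> int) : V := \sum_i chi i *~ z i.

Lemma wordB z z' : word z - word z' = word (fun i => z i - z' i).
Proof. by rewrite /word -sumrB; apply: eq_bigr => i _; rewrite mulrzBr. Qed.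

Lemma wordMz z c : word z *~ c = word (fun i => z i * c).
Proof.
by rewrite /word mulrz_suml; apply: eq_bigr => i _; rewrite mulrzA.
Qed.

Lemma word_sum (I : finType) (z : I -> 'I_m -> int) :
  \sum_s word (z s) = word (fun i => \sum_s z s i).
Proof.
rewrite /word exchange_big; apply: eq_bigr => i _.
by rewrite mulrz_sumr.
Qed.

Lemma wordDl i z : chi i + word z = word (fun l => (l == i)%:R + z l).
Proof.
rewrite /word -[X in X + _](_ : \sum_l chi l *~ (l == i)%:R = chi i).
  by rewrite -big_split/=; apply: eq_bigr => l _; rewrite mulrzDr.
rewrite (bigD1 i)//= eqxx big1 ?addr0// => l /negbTE ->.
by rewrite mulr0z.
Qed.

(* Exponents up to [N] with [N] chosen so that the set of words grows by a
   factor at most [1 + eta] from [N] to [N + 1]: a Folner set. *)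
Lemma folner_words (R : realType) (eta : R) : 0 < eta ->
  exists (r N : nat) (e : 'I_r -> 'I_m -> int),
    [/\ (0 < r)%N, forall s i, (`|e s i| <= N)%N,
        injective (word \o e) &
        forall i, exists S : pred 'I_r,
          (1 - eta) * r%:R <= #|S|%:R /\
          forall t, t \in S -> exists s, word (e s) = chi i + word (e t)].
Proof.
move=> eta0.
pose B N := undup [seq word (fun i => Posz (f i)) | f : {ffun 'I_m -> 'I_N}].
have Bmem N (z : 'I_m -> nat) : (forall i, z i < N)%N ->
    word (fun i => Posz (z i)) \in B N.
  move=> zN; rewrite mem_undup; apply/mapP.
  exists [ffun i => Ordinal (zN i)]; first by rewrite mem_enum.
  by congr word; apply/funext => i; rewrite ffunE.
have BP N v : v \in B N -> exists2 z : 'I_m -> nat,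
    (forall i, z i < N)%N & v = word (fun i => Posz (z i)).
  rewrite mem_undup => /mapP[f _ ->]; exists (fun i => val (f i)) => // i.
  exact: ltn_ord.
have bN N : (size (B N) <= N ^ m)%N.
  rewrite (leq_trans (size_undup _))// size_map -cardE card_ffun !card_ord//.
have b1 : (0 < size (B 1%N))%N.
  rewrite lt0n size_eq0; apply/eqP => B0.
  by have := Bmem 1%N (fun=> 0%N) (fun=> isT); rewrite B0.
have [N N0 ratio] := polynomial_growth_ratio b1 bN eta0.
set r := size (B N) in ratio.
pose beta (s : 'I_r) := nth 0 (B N) s.
have betaB s : beta s \in B N by rewrite mem_nth.
have uB N' : uniq (B N') by exact: undup_uniq.
have binj : injective beta.
  by move=> s t /eqP; rewrite nth_uniq// => /eqP/val_inj.
have /choice[z hz] : forall s, exists z : 'I_m -> nat,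
    (forall i, z i < N)%N /\ beta s = word (fun i => Posz (z i)).
  by move=> s; have [z ? ?] := BP _ _ (betaB s); exists z.
exists r, N, (fun s i => Posz (z s i)); split.
- rewrite lt0n size_eq0; apply/eqP => B0.
  by have := Bmem N (fun=> 0%N) (fun=> N0); rewrite B0.
- by move=> s i; rewrite absz_nat ltnW// (hz s).1.
- by move=> s t /= h; apply: binj; rewrite (hz s).2 (hz t).2.
move=> i; exists [pred t | chi i + beta t \in B N]; split; last first.
  move=> t; rewrite inE => tB; have [z' _ _] := BP _ _ tB.
  have lt : (index (chi i + beta t)%R (B N) < r)%N by rewrite index_mem.
  exists (Ordinal lt); rewrite -!(hz _).2 /beta/= nth_index//.
set S := [pred t | _].
have cS : (#|[predC S]| + r <= size (B N.+1))%N.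
  rewrite cardE -(size_map (fun t => chi i + beta t)) -size_cat.
  apply: uniq_leq_size.
    rewrite cat_uniq uB andbT map_inj_uniq ?enum_uniq/=; last first.
      by move=> s t /addrI/binj.
    apply/hasPn => v vB; apply/mapP => -[t]; rewrite mem_enum inE => tS vE.
    by move/negP: tS; apply; rewrite inE -vE.
  move=> v; rewrite mem_cat => /orP[/mapP[t _ ->]|/BP[z' z'N ->]].
    rewrite (hz t).2 wordDl.
    rewrite (_ : (fun l => _) = fun l => Posz ((l == i) + z t l)%N).
      apply: Bmem => l; rewrite ltnS (leq_trans (leq_add (leq_b1 _) (leqnn _)))//.
      by rewrite add1n (hz t).1.
    by apply/funext => l; rewrite PoszD; case: (l == i).
  by apply: Bmem => l; rewrite ltnW// ltnS z'N.
have := cardC S; rewrite card_ord => rE.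
have rE' : r%:R = #|S|%:R + #|[predC S]|%:R :> R by rewrite -natrD -[in LHS]rE.
have : #|[predC S]|%:R + r%:R <= (1 + eta) * r%:R :> R.
  by rewrite -natrD (le_trans _ ratio)// ler_nat.
rewrite rE'; lra.
Qed.

End words.

(** * Transfer along partial isomorphisms *)

Section bessel.
Context (R : realType) (A : compactAbelianGroup R).
Local Notation E := (cexpectation (haar A)).
Local Notation sq := (sqn (haar A)).

Lemma bessel_inequality (f : A -> R[i]) (l : seq (adual A)) :
  bm (f : borel A -> R[i]) -> uniq l ->
  \sum_(chi <- l) `|fourier f chi| ^+ 2 <= sq f.
Proof.
move=> bf ul.
pose v : borel A -> R[i] := fun x => \sum_(chi <- l) fourier f chi * chi x.
have bv : bm v by apply: bm_sum => chi; apply: bmZ; exact: bm_char.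
have dot (u : borel A -> R[i]) : bm u -> E (fun x => u x * (v x)^*) =
    \sum_(chi <- l) (fourier f chi)^* * fourier u chi.
  move=> bu.
  transitivity (E (fun x => \sum_(chi <- l) (fourier f chi)^* * (u x * (chi x)^*))).
    apply: eq_cexp => x; rewrite /v rmorph_sum mulr_sumr; apply: eq_bigr => chi _.
    by rewrite /= conjcM mulrCA.
  rewrite cexp_sum; last by move=> chi; apply: bmZ; exact: bm_char_mul.
  by apply: eq_bigr => chi _; rewrite cexpZ//; exact: bm_char_mul.
have fv (chi : adual A) : chi \in l -> fourier v chi = fourier f chi.
  move=> chil.
  transitivity (\sum_(psi <- l) fourier f psi * fourier (psi : A -> R[i]) chi).
    transitivity (E (fun x => \sum_(psi <- l) fourier f psi * (psi x * (chi x)^*))).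
      apply: eq_cexp => x; rewrite /v mulr_suml; apply: eq_bigr => psi _.
      by rewrite mulrA.
    rewrite cexp_sum; last first.
      by move=> psi; apply: bmZ; apply: bm_char_mul; exact: bm_char.
    by apply: eq_bigr => psi _; rewrite cexpZ//; apply: bm_char_mul; exact: bm_char.
  rewrite (bigD1_seq chi)//= fourier_char eqxx mulr1 big1 ?addr0// => psi.
  by move=> /negbTE pc; rewrite fourier_char pc mulr0.
pose S := \sum_(chi <- l) `|fourier f chi| ^+ 2.
have fS : E (fun x => f x * (v x)^*) = S.
  by rewrite dot//; apply: eq_bigr => chi _; rewrite normCK mulrC.
have vS : sq v = S.
  rewrite [LHS]dot// [LHS]big_seq [RHS]big_seq; apply: eq_bigr => chi chil.
  by rewrite fv// normCK mulrC.
have SJ : S^* = S.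
  by rewrite geC0_conj// -vS; exact: sqn_ge0.
have := sqn_ge0 (haar A) (fun x => f x - v x).
by rewrite sqnB// fS vS SJ subrK subr_ge0.
Qed.

Lemma large_spectrum_finite (f : A -> R[i]) (a e : R) :
  bm (f : borel A -> R[i]) -> (forall x, `|f x| <= a%:C) -> 0 < e ->
  exists l : seq (adual A), forall chi, (chi \in l) <-> e%:C < `|fourier f chi|.
Proof.
move=> bf fa e0.
pose S : set (adual A) := [set chi | e%:C < `|fourier f chi|].
suff /finite_seqP[l Sl] : finite_set S.
  by exists l => chi; have := congr1 (fun X : set _ => X chi) Sl; rewrite /S/= => <-.
apply: contrapT => infS.
pose x := a ^+ 2 / e ^+ 2.
have [B BS szB] := infinite_set_fset (Num.truncn x).+1 infS.
have := bessel_inequality bf (finmap.fset_uniq B).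
apply/negP; rewrite -real_ltNge; last 2 first.
- by rewrite ger0_real// sqn_ge0.
- by rewrite ger0_real//; apply: sumr_ge0 => chi _; rewrite exprn_ge0.
apply: le_lt_trans (sqn_le (haar A) bf fa) _.
apply: (@lt_le_trans _ _ (\sum_(chi <- finmap.enum_fset B) (e ^+ 2)%:C)); last first.
  rewrite big_seq [leRHS]big_seq; apply: ler_sum => chi chiB.
  have h : S chi by apply: BS; exact: chiB.
  rewrite rcX; apply: lerXn2r; [|by rewrite nnegrE|exact: ltW h].
  by rewrite nnegrE ler0c ltW.
rewrite big_const_seq count_predT iter_addr_0 -mulr_natr -rc_nat -rcX -rcM ltcR.
rewrite mulrC -ltr_pdivrMr ?exprn_gt0// -/x.
rewrite (lt_le_trans (truncnS_gt x))// ler_nat.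
exact: szB.
Qed.

End bessel.

Section transfer.
Context (R : realType) (A B : compactAbelianGroup R).
Variables (n : nat) (S1 : set (dual A)) (S2 : set (dual B)).
Variable phi : dual A -> dual B.
Hypothesis phiP : partial_isomorphism n S1 S2 phi.

Lemma sum_ord_nth (V : zmodType) (T : Type) (l : seq T) (d : T) (g : T -> V) N :
  (size l <= N)%N -> g d = 0 -> \sum_(i < N) g (nth d l i) = \sum_(p <- l) g p.
Proof.
move=> lN gd; rewrite (big_nth d) big_mkord [RHS](big_ord_widen N (fun i => g (nth d l i)))//.
rewrite [LHS](bigID (fun i : 'I_N => (i < size l)%N))/= [X in _ + X]big1 ?addr0//.
by move=> i; rewrite -leqNgt => li; rewrite nth_default.
Qed.

Lemma partial_isomorphism_signs (l : seq (dual A * int)) :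
  (forall p, p \in l -> S1 p.1 /\ p.2 \in [:: -1; 0; 1]) -> (size l <= n)%N ->
  (\sum_(p <- l) (p.1 : adual A) *~ p.2 = 0) <->
  (\sum_(p <- l) (phi p.1 : adual B) *~ p.2 = 0).
Proof.
case: l => [|p0 l] hl ln; first by rewrite !big_nil.
set l' := p0 :: l in hl ln *.
pose d : dual A * int := (p0.1, 0).
have dl (i : 'I_n) : S1 (nth d l' i).1 /\ (nth d l' i).2 \in [:: -1; 0; 1].
  have [li|li] := ltnP i (size l'); first by apply: hl; exact: mem_nth.
  rewrite nth_default//; split => //.
  by apply: (hl p0 _).1; rewrite inE eqxx.
have := phiP.2 (fun i => (nth d l' i).1) (fun i => (nth d l' i).2)
  (fun i => (dl i).1) (fun i => (dl i).2).
rewrite !prodgE.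
under eq_bigr do rewrite int_expgE.
under [X in _ <-> X = _]eq_bigr do rewrite int_expgE.
rewrite (sum_ord_nth (g := fun p => (p.1 : adual A) *~ p.2))//.
by rewrite (sum_ord_nth (g := fun p => (phi p.1 : adual B) *~ p.2)).
Qed.

Lemma sum_nseq_sgz (V : zmodType) (g : V) (z : int) (T : Type) (t : T) :
  \sum_(q <- nseq `|z|%N t) g *~ sgz z = g *~ z.
Proof.
rewrite big_const_seq count_predT size_nseq iter_addr_0 pmulrn -mulrzA.
by rewrite -intEsg.
Qed.

Lemma partial_isomorphism_ints (l : seq (dual A * int)) :
  (forall p, p \in l -> S1 p.1) -> (\sum_(p <- l) `|p.2| <= n)%N ->
  (\sum_(p <- l) (p.1 : adual A) *~ p.2 = 0) <->
  (\sum_(p <- l) (phi p.1 : adual B) *~ p.2 = 0).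
Proof.
move=> hl ln.
pose l' := flatten [seq nseq `|p.2|%N (p.1, sgz p.2) | p <- l].
have sl : (size l' <= n)%N.
  rewrite size_flatten /shape -map_comp sumnE big_map (leq_trans _ ln)//.
  by apply: leq_sum => p _ /=; rewrite size_nseq.
have h : forall p, p \in l' -> S1 p.1 /\ p.2 \in [:: -1; 0; 1].
  move=> p /flattenP[_ /mapP[q ql ->]] /nseqP[-> _]; split; first exact: (hl q).
  by rewrite /= !inE; case: (q.2) => [[|c]|c].
have := partial_isomorphism_signs h sl.
have e (V : zmodType) (u : dual A -> V) :
    \sum_(p <- l') u p.1 *~ p.2 = \sum_(p <- l) u p.1 *~ p.2.
  rewrite big_flatten big_map; apply: eq_bigr => p _.
  rewrite -(sum_nseq_sgz (u p.1) p.2 (p.1, sgz p.2)).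
  by rewrite big_seq [RHS]big_seq; apply: eq_bigr => q /nseqP[-> _].
by rewrite (e (adual A) id) (e (adual B) phi).
Qed.

Variables (m : nat) (chi : 'I_m -> dual A).
Hypothesis chiS : forall i, S1 (chi i).
Let chi' : 'I_m -> adual B := fun i => phi (chi i).

Lemma word_transfer (z : 'I_m -> int) : (\sum_i `|z i| <= n)%N ->
  (word (chi : 'I_m -> adual A) z = 0) <-> (word chi' z = 0).
Proof.
move=> zn; pose l := [seq (chi i, z i) | i <- index_enum 'I_m].
have hl : forall p, p \in l -> S1 p.1 by move=> p /mapP[i _ ->]; exact: chiS.
have ln : (\sum_(p <- l) `|p.2| <= n)%N by rewrite big_map.
by have := partial_isomorphism_ints hl ln; rewrite !big_map.
Qed.

Lemma word_transfer_mem (g : dual A) (z : 'I_m -> int) : S1 g ->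
  (\sum_i `|z i| < n)%N ->
  ((g : adual A) = word (chi : 'I_m -> adual A) z) <->
  ((phi g : adual B) = word chi' z).
Proof.
move=> gS zn; pose l := (g, -1) :: [seq (chi i, z i) | i <- index_enum 'I_m].
have hl : forall p, p \in l -> S1 p.1.
  by move=> p; rewrite inE => /orP[/eqP->//|/mapP[i _ ->]]; exact: chiS.
have ln : (\sum_(p <- l) `|p.2| <= n)%N by rewrite big_cons big_map.
have := partial_isomorphism_ints hl ln; rewrite !big_cons !big_map/=.
rewrite !mulrNz !mulr1z ![- _ + _]addrC.
have e (V : zmodType) (u v : V) : (v - u = 0) <-> (u = v).
  by split=> [/eqP|->]; [rewrite subr_eq0 => /eqP ->|rewrite subrr].
by move=> h; split => /e/h/e.
Qed.

End transfer.

Lemma prodr_dist_le (K : numDomainType) (I : Type) (l : seq I) (x y : I -> K)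
    (M d : K) : 1 <= M -> 0 <= d -> (forall i, `|x i| <= M) ->
  (forall i, `|y i| <= M) -> (forall i, `|x i - y i| <= d) ->
  `|\prod_(i <- l) x i - \prod_(i <- l) y i| <= (size l)%:R * M ^+ size l * d.
Proof.
move=> M1 d0 xM yM xyd; have M0 : 0 <= M := le_trans ler01 M1.
have pM (u : I -> K) l' : (forall i, `|u i| <= M) ->
    `|\prod_(i <- l') u i| <= M ^+ size l'.
  move=> uM; elim: l' => [|i l' IH]; first by rewrite big_nil normr1.
  by rewrite big_cons normrM exprS ler_pM.
elim: l => [|i l IH]; first by rewrite !big_nil subrr normr0 mul0r mul0r.
rewrite !big_cons (_ : _ - _ = (x i - y i) * \prod_(j <- l) x j +
  y i * (\prod_(j <- l) x j - \prod_(j <- l) y j)); last by ring.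
rewrite (le_trans (ler_normD _ _))// !normrM.
have h1 : `|x i - y i| * `|\prod_(j <- l) x j| <= d * M ^+ (size l).+1.
  rewrite ler_pM//; apply: le_trans (pM _ _ xM) _.
  by rewrite exprS ler_peMl// exprn_ge0.
have h2 : `|y i| * `|\prod_(j <- l) x j - \prod_(j <- l) y j| <=
    M * ((size l)%:R * M ^+ size l * d) by rewrite ler_pM.
rewrite (le_trans (lerD h1 h2))//= -natr1 exprS le_eqVlt; apply/orP; left.
by apply/eqP; ring.
Qed.

Section fourier_bounds.
Context (R : realType) (A : compactAbelianGroup R) (a : R).
Variable f : A -> R[i].
Hypotheses (bf : bm (f : borel A -> R[i])) (fa : forall x, `|f x| <= a%:C).

Lemma fourier_le (psi : dual A) : `|fourier f psi| <= a%:C.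
Proof.
apply: norm_cexp_le => [|x]; first exact: bm_char_mul.
by rewrite normrM norm_conjC char_norm mulr1.
Qed.

Lemma fourier_smooth_close (r : nat) (beta : 'I_r -> adual A) (e1 eta : R)
    (psi : adual A) : injective beta -> (0 < r)%N -> 0 <= e1 -> 0 <= eta ->
  eta * a <= e1 ->
  `|fourier f psi| <= e1%:C \/ (1 - eta) * r%:R <= (fejer_weight beta psi)%:R ->
  `|fourier f psi - fourier (smooth beta f) psi| <= e1%:C.
Proof.
move=> injb r0 e0 eta0 etaa h.
pose c : R := (fejer_weight beta psi)%:R / r%:R.
have rp : 0 < r%:R :> R by rewrite ltr0n.
have c0 : 0 <= c by rewrite divr_ge0.
have c1 : c <= 1.
  by rewrite ler_pdivrMr// mul1r ler_nat -[X in (_ <= X)%N]card_ord card_diff_le.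
have -> : fourier f psi - fourier (smooth beta f) psi = fourier f psi * (1 - c)%:C.
  by rewrite fourier_smooth card_ord rcB /c rcM rcV !rc_nat mulrBr mulr1.
rewrite normrM rc_norm (ger0_norm (_ : 0 <= 1 - c)) ?subr_ge0//.
case: h => [h|h].
  by rewrite (le_trans _ h)// ler_piMr// lecR lerBlDr lerDl.
rewrite (@le_trans _ _ (a%:C * eta%:C))//; last by rewrite -rcM lecR mulrC.
apply: ler_pM => //; [by rewrite ler0c subr_ge0|exact: fourier_le|].
by rewrite lecR lerBlDr -lerBlDl ler_pdivlMr.
Qed.

End fourier_bounds.

Section continuity.
Context (R : realType) (k n : nat) (L : 'M[int]_(k, n)).
Variables (F : compactAbelianGroup R -> Prop) (a : R).
Hypotheses (LF : true_complexity_le1 L F) (a0 : 0 < a).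

Lemma dhat_lt (A B : compactAbelianGroup R) (f : A -> R[i]) (g : B -> R[i])
    (d : R) : bm (f : borel A -> R[i]) -> bm (g : borel B -> R[i]) ->
  (forall x, `|f x| <= a%:C) -> (forall x, `|g x| <= a%:C) ->
  dhat (fourier f) (fourier g) < d ->
  exists2 e, 0 < e < d & exists S1 S2 phi,
    eps_isomorphism e (fourier f) (fourier g) S1 S2 phi.
Proof.
move=> bf bg fa ga fgd.
have ne : [set eps : R | 0 < eps /\ exists S1 S2 phi,
    eps_isomorphism eps (fourier f) (fourier g) S1 S2 phi] !=set0.
  exists (a + 1); split; first by rewrite addr_gt0.
  have a1 : 0 < a + 1 by rewrite addr_gt0.
  have big (C : compactAbelianGroup R) (h : C -> R[i]) :
      bm (h : borel C -> R[i]) -> (forall x, `|h x| <= a%:C) ->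
      supp (a + 1) (fourier h) `<=` set0.
    move=> bh ha chi; rewrite /supp/= => /ltW h1.
    have := fourier_le bh ha chi; rewrite normC_normc lecR => /(le_trans h1).
    by rewrite gerDl lt_geF// ltr01.
  exists set0, set0, (fun=> dual_one B); split => //; [|exact: big|exact: big].
  split; first by split; [move=> ? []|move=> ? ? /set_mem|move=> ? []].
  move=> g0 al gS; have n0 : (0 < `|Num.ceil (a + 1)^-1|)%N.
    by rewrite absz_gt0 gt_eqF// ceil_gt0 invr_gt0.
  by case: (gS (Ordinal n0)).
have [e [e0 he] ed] := inf_lt ne fgd.
by exists e => //; rewrite e0.
Qed.

End continuity.

Lemma absz_boolDB_le (b : bool) (x y : int) (N : nat) :
  (`|x| <= N)%N -> (`|y| <= N)%N -> (`|(b%:R + x - y)%R| <= b + 2 * N)%N.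
Proof. by case: b => /=; lia. Qed.

Lemma absz_sum_le (I : Type) (l : seq I) (h : I -> int) :
  (`|(\sum_(x <- l) h x)%R| <= \sum_(x <- l) `|h x|)%N.
Proof.
have absD (x y : int) : (`|(x + y)%R| <= `|x| + `|y|)%N by lia.
elim: l => [|x l IH]; first by rewrite !big_nil.
by rewrite !big_cons (leq_trans (absD _ _))// leq_add2l.
Qed.

Lemma word_fourier_close (R : realType) (A B : compactAbelianGroup R)
    (e : R) (f1 : dual A -> R[i]) (f2 : dual B -> R[i]) (S1 : set (dual A))
    (S2 : set (dual B)) (phi : dual A -> dual B) (m : nat)
    (chi : 'I_m -> dual A) (z : 'I_m -> int) : 0 < e ->
  eps_isomorphism e f1 f2 S1 S2 phi -> (forall i, S1 (chi i)) ->
  (\sum_i `|z i| < `|Num.ceil e^-1|)%N ->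
  `|f1 (word (chi : 'I_m -> adual A) z) -
    f2 (word (fun i => phi (chi i) : adual B) z)| <= (2 * e)%:C.
Proof.
move=> e0 [phiP f1S f2S f12] chiS zn.
set g := word _ z; set g' := word _ z.
have [gS|gS] := pselect (S1 g).
  have g'E : phi g = g' by apply/(word_transfer_mem phiP chiS gS zn).
  rewrite -g'E normC_normc lecR (le_trans (f12 _ gS))//.
  by rewrite mulr_natl mulr2n lerDl ltW.
have small (G : groupType) (S : set G) (h : G -> R[i]) (x : G) :
    supp e h `<=` S -> ~ S x -> `|h x| <= e%:C.
  by move=> hS xS; rewrite normC_normc lecR leNgt; apply/negP => /hS.
have g'S : ~ S2 g'.
  move=> g'S; have [_ _ surj] := phiP.1; have [x xS xg'] := surj g' g'S.
  apply: gS.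
  by have <- : x = g by apply/(word_transfer_mem phiP chiS xS zn).
rewrite mulr_natl mulr2n rcD (le_trans (ler_normB _ _))// lerD//.
  exact: (small _ S1).
exact: (small _ S2).
Qed.

Section continuity.
Context (R : realType) (k n : nat) (L : 'M[int]_(k, n)).
Variables (F : compactAbelianGroup R -> Prop) (a : R).
Hypotheses (LF : true_complexity_le1 L F) (a0 : 0 < a).

Lemma density_smooth_close (A B : compactAbelianGroup R) (r : nat)
    (beta : 'I_r -> adual A) (beta' : 'I_r -> adual B)
    (f : A -> R[i]) (g : B -> R[i]) (M d : R) : 1 <= M -> 0 <= d ->
  (forall p, `|fourier f (diff_char beta p)| <= M%:C) ->
  (forall p, `|fourier g (diff_char beta' p)| <= M%:C) ->
  (forall p, `|fourier f (diff_char beta p) - fourier g (diff_char beta' p)| <= d%:C) ->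
  (forall (s : 'I_k -> 'I_r * 'I_r) j,
    (\sum_i diff_char beta (s i) *~ L i j = 0) <->
    (\sum_i diff_char beta' (s i) *~ L i j = 0)) ->
  `|density L (smooth beta f) - density L (smooth beta' g)| <=
    (r%:R^-1 ^+ k * (#|{ffun 'I_k -> 'I_r * 'I_r}|%:R * (k%:R * M ^+ k * d)))%:C.
Proof.
move=> M1 d0 fM gM fg rel; rewrite !density_smooth card_ord -mulrBr normrM.
rewrite rcM rcX rcV rc_nat ger0_norm ?exprn_ge0 ?invr_ge0//.
apply: ler_wpM2l; first by rewrite exprn_ge0 ?invr_ge0.
have relE (s : {ffun 'I_k -> 'I_r * 'I_r}) :
    [forall j, \sum_i diff_char beta' (s i) *~ L i j == 0] =
    [forall j, \sum_i diff_char beta (s i) *~ L i j == 0].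
  by apply: eq_forallb => j; apply/eqP/eqP => /(rel s j).
under [X in _ - X]eq_bigr do rewrite relE.
rewrite -sumrB; under eq_bigr do rewrite -mulrBl.
rewrite (le_trans (ler_norm_sum _ _ _))//.
rewrite rcM rc_nat mulr_natl -sumr_const; apply: ler_sum => s _.
rewrite normrM.
have Mk0 : 0 <= (k%:R * M ^+ k * d)%:C :> R[i].
  by rewrite ler0c !mulr_ge0// exprn_ge0// (le_trans ler01).
rewrite (le_trans (ler_wpM2l _ (_ : `|_| <= 1)))//.
  by case: [forall _, _]; rewrite ?normr1 ?normr0.
rewrite mulr1 !rcM rcX rc_nat.
have := @prodr_dist_le _ _ (index_enum 'I_k) (fun i => fourier f (diff_char beta (s i)))
  (fun i => fourier g (diff_char beta' (s i))) M%:C d%:C.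
rewrite -[size _]/(size (index_enum 'I_k)) (_ : size (index_enum 'I_k) = k); last first.
  by rewrite -[RHS]card_ord cardT enumT.
by apply => //; rewrite ?ler0c// lecR.
Qed.

Lemma density_continuous (A : compactAbelianGroup R) (f : A -> R[i]) (eps : R) :
  F A -> bm (f : borel A -> R[i]) -> (forall x, `|f x| <= a%:C) -> 0 < eps ->
  exists2 delta : R, 0 < delta & forall (B : compactAbelianGroup R) (g : B -> R[i]),
    F B -> bm (g : borel B -> R[i]) -> (forall x, `|g x| <= a%:C) ->
    dhat (fourier f) (fourier g) < delta ->
    `|density L f - density L g| < eps%:C.
Proof.
move=> FA bf fa eps0.
have eps4 : 0 < eps / 4 by rewrite divr_gt0.
have [e1 e10 close] := density_close LF a0 eps4.
have e12 : 0 < e1 / 2 by rewrite divr_gt0.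
have [l lP] := large_spectrum_finite bf fa e12.
pose m := size l; pose chi (i : 'I_m) : adual A := nth 0 l i.
pose eta := e1 / a; have eta0 : 0 < eta by rewrite divr_gt0.
have etaa : eta * a <= e1 by rewrite divfK// gt_eqF.
have [r [N [e [r0 eN inje folner]]]] := folner_words chi eta0.
pose beta s := word chi (e s).
pose Lam := (\sum_i \sum_j `|L i j|)%N.
pose W := (m * (2 * N * Lam.+1).+1).+1.
pose M := a + 1; have M1 : 1 <= M by rewrite lerDr ltW.
pose C : R := r%:R^-1 ^+ k * (#|{ffun 'I_k -> 'I_r * 'I_r}|%:R * (k%:R * M ^+ k)) + 1.
have C0 : 0 < C.
  rewrite ltr_wpDl// !mulr_ge0// ?exprn_ge0 ?invr_ge0//.
  exact: le_trans ler01 M1.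
exists (Num.min (e1 / 2) (Num.min W%:R^-1 (eps / 8 / C))).
  by rewrite !lt_min e12 invr_gt0 ltr0n/= !divr_gt0.
move=> B g FB bg ga fg.
have [e' /andP[e'0 e'd] [S1 [S2 [phi iso]]]] := dhat_lt a0 bf bg fa ga fg.
move: e'd; rewrite !lt_min => /and3P[e'e1 e'W e'C].
have [phiP f1S f2S f12] := iso.
set w := `|Num.ceil e'^-1|%N in phiP.
have Ww : (W <= w)%N.
  rewrite -(ler_nat R) /w natr_absz ger0_norm; last first.
    by rewrite ceil_ge0// (lt_trans (ltrN10 _))// invr_gt0.
  rewrite (le_trans _ (ceil_ge _))// -[W%:R]invrK lef_pV2 ?posrE ?invr_gt0 ?ltr0n//.
  exact: ltW.
have chiS i : S1 (chi i).
  have : e'%:C < `|fourier f (chi i)|.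
    apply: (@lt_trans _ _ (e1 / 2)%:C); first by rewrite ltcR.
    by apply/lP; rewrite mem_nth.
  by rewrite normC_normc ltcR => h; exact: f1S.
pose chi' i : adual B := phi (chi i).
pose beta' s := word chi' (e s).
have bound (z : 'I_m -> int) : (forall i, (`|z i| <= (2 * N * Lam.+1).+1)%N) ->
    (\sum_i `|z i| < w)%N.
  move=> zb; apply: leq_trans Ww; rewrite /W ltnS.
  rewrite -[X in (_ <= X * _)%N]card_ord -sum_nat_const; apply: leq_sum => i _.
  exact: zb.
have tr z : (forall i, (`|z i| <= (2 * N * Lam.+1).+1)%N) ->
    (word chi z = 0) <-> (word chi' z = 0).
  by move=> /bound/ltnW; exact: (word_transfer phiP chiS).
have diffN s t i : (`|e s i - e t i| <= 2 * N)%N.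
  by have := @absz_boolDB_le false _ _ _ (eN s i) (eN t i); rewrite add0r.
have leN x : (x <= 2 * N -> x <= (2 * N * Lam.+1).+1)%N.
  by move=> /leq_trans; apply; rewrite leqW// leq_pmulr.
have injb : injective beta by [].
have injb' : injective beta'.
  move=> s t /eqP; rewrite -subr_eq0 wordB => /eqP/tr st.
  apply: injb; apply/eqP; rewrite -subr_eq0 wordB; apply/eqP; apply: st => i.
  exact: leN.
have weight (i : 'I_m) : (1 - eta) * r%:R <= (fejer_weight beta (chi i))%:R /\
    (1 - eta) * r%:R <= (fejer_weight beta' (chi' i))%:R.
  have [S [cS hS]] := folner i; split; apply: le_trans cS _; rewrite ler_nat.
    exact: card_diff_ge.
  apply: card_diff_ge => t /hS[s hs]; exists s.
  have wE (V : zmodType) (u : 'I_m -> V) :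
      word u (fun j => (j == i)%:R + e t j - e s j) =
      u i + word u (e t) - word u (e s) by rewrite wordDl wordB.
  apply/esym/eqP; rewrite -subr_eq0 /beta' -wE; apply/eqP/tr; last first.
    by rewrite wE -hs subrr.
  move=> j; apply: (@leq_trans (2 * N).+1); last by rewrite ltnS leq_pmulr.
  apply: leq_trans (absz_boolDB_le _ (eN t j) (eN s j)) _.
  by case: (j == i); rewrite ?add1n ?add0n.
have r0' : (0 < #|'I_r|)%N by rewrite card_ord.
have cf : `|density L f - density L (smooth beta f)| <= (eps / 4)%:C.
  apply: close => //; first exact: bm_smooth.
    by move=> x; apply: smooth_le => //; exact: ltW.
  move=> psi; apply: (fourier_smooth_close bf fa injb r0 (ltW e10) (ltW eta0) etaa).
  have [psil|psil] := boolP (psi \in l).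
    right; have il : (index psi l < m)%N by rewrite index_mem.
    by have := (weight (Ordinal il)).1; rewrite /chi/= nth_index.
  left; rewrite normC_normc lecR leNgt; apply: contra psil => h; apply/lP.
  rewrite normC_normc ltcR; apply: lt_trans h.
  by rewrite ltr_pdivrMr// mulr_natr mulr2n ltrDl.
have cg : `|density L g - density L (smooth beta' g)| <= (eps / 4)%:C.
  apply: close => //; first exact: bm_smooth.
    by move=> x; apply: smooth_le => //; exact: ltW.
  move=> psi; apply: (fourier_smooth_close bg ga injb' r0 (ltW e10) (ltW eta0) etaa).
  have [[i ->]|npsi] := pselect (exists i, psi = chi' i).
    by right; exact: (weight i).2.
  left; rewrite normC_normc lecR.
  have [psiS|psiS] := pselect (S2 psi); last first.
    rewrite leNgt; apply/negP => h; apply: psiS; apply: f2S.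
    by rewrite /supp; apply: lt_trans h; lra.
  have [_ _ surj] := phiP.1; have [x xS xpsi] := surj psi psiS.
  have xl : x \notin l.
    apply/negP => xl; apply: npsi; have il : (index x l < m)%N by rewrite index_mem.
    by exists (Ordinal il); rewrite /chi' /chi/= nth_index.
  have fx : normc (fourier f x) <= e1 / 2.
    rewrite leNgt; apply: contra xl => h; apply/lP.
    by rewrite normC_normc ltcR.
  have d : normc (fourier g psi - fourier f x) <= e'.
    by rewrite -normcN opprB -xpsi; exact: f12.
  rewrite -lecR -normC_normc -[fourier g psi](subrK (fourier f x)) addrC.
  rewrite (le_trans (ler_normD _ _))// !normC_normc -rcD lecR.
  lra.
have cm : `|density L (smooth beta f) - density L (smooth beta' g)| <=
    ((C - 1) * (2 * e'))%:C.
  have zb p i : (`|(e p.1 i - e p.2 i)%R| <= (2 * N * Lam.+1).+1)%N by exact: leN.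
  have diffE (B' : compactAbelianGroup R) (u : 'I_m -> adual B') p :
      diff_char (fun s => word u (e s)) p = word u (fun i => e p.1 i - e p.2 i).
    exact: wordB.
  have -> : (C - 1) * (2 * e') = r%:R^-1 ^+ k *
      (#|{ffun 'I_k -> 'I_r * 'I_r}|%:R * (k%:R * M ^+ k * (2 * e'))).
    by rewrite /C addrK !mulrA.
  apply: density_smooth_close => //.
  - by rewrite mulr_ge0// ltW.
  - by move=> p; apply: le_trans (fourier_le bf fa _) _; rewrite lecR lerDl ler01.
  - by move=> p; apply: le_trans (fourier_le bg ga _) _; rewrite lecR lerDl ler01.
  - move=> p; rewrite /beta /beta' !diffE.
    exact: (word_fourier_close e'0 iso chiS (bound _ (zb p))).
  move=> s j.
  have sumE (B' : compactAbelianGroup R) (u : 'I_m -> adual B') :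
      \sum_i diff_char (fun s => word u (e s)) (s i) *~ L i j =
      word u (fun l => \sum_i (e (s i).1 l - e (s i).2 l) * L i j).
    by rewrite -word_sum; apply: eq_bigr => i _; rewrite diffE wordMz.
  rewrite /beta /beta' !sumE; apply: tr => i.
  rewrite (@leq_trans (2 * N * Lam))//; last by rewrite leqW// leq_mul2l leqnSn orbT.
  apply: leq_trans (absz_sum_le _ _) _.
  rewrite /Lam big_distrr/=; apply: leq_sum => i' _; rewrite abszM leq_mul//.
  by rewrite (bigD1 j)//= leq_addr.
have small : (C - 1) * (2 * e') <= eps / 4.
  rewrite ltr_pdivlMr// in e'C; nra.
rewrite (_ : _ - _ = (density L f - density L (smooth beta f)) +
  (density L (smooth beta f) - density L (smooth beta' g)) -
  (density L g - density L (smooth beta' g))); last by ring.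
apply: (@le_lt_trans _ _ (eps / 4 + eps / 4 + eps / 4)%:C); last by rewrite ltcR; lra.
rewrite (le_trans (ler_normB _ _))// rcD lerD// (le_trans (ler_normD _ _))// rcD lerD//.
by rewrite (le_trans cm)// lecR.
Qed.

End continuity.

Lemma fourier_truncate (R : realType) (A : compactAbelianGroup R) (a : R)
    (f : A -> R[i]) : 0 < a -> Linfty_ball a f ->
  fourier (truncate a f) = fourier f.
Proof.
move=> a0 fa; have [mf _] := fa; apply/funext => chi.
have mchi : cmeasurable (fun x : borel A => (chi x)^*).
  exact: (bmJ (bm_char chi)).1.
apply: ae_eq_cexp.
- by apply: cmeasurableM => //; exact: (bm_truncate a0 mf).1.
- exact: cmeasurableM.
- by have := truncate_ae fa; apply: filterS => x /= <-.
Qed.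

Local Open Scope complex_scope.

(* The first conclusion says that the density is well defined on isomorphism
   classes, the second that it is continuous for the metric fdist. *)
Theorem theorem4p2 (R : realType) (a : R) (k n : nat) (L : 'M[int]_(k, n))
    (F : compactAbelianGroup R -> Prop) :
  0 < a ->
  true_complexity_le1 L F ->
  (forall (A B : compactAbelianGroup R) (f : A -> R[i]) (g : B -> R[i]),
     F A -> F B -> Linfty_ball a f -> Linfty_ball a g ->
     isomorphic f g -> density L f = density L g) /\
  (forall (A : compactAbelianGroup R) (f : A -> R[i]),
     F A -> Linfty_ball a f ->
     forall eps : R, 0 < eps -> exists2 delta : R, 0 < delta &
       forall (B : compactAbelianGroup R) (g : B -> R[i]),
         F B -> Linfty_ball a g ->
         fdist f g < delta -> normc (density L f - density L g) < eps).
Proof.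
move=> a0 LF; split.
  by move=> A B f g FA FB fa ga; exact: (isomorphic_density LF a0 FA FB fa ga).
move=> A f FA fa eps eps0.
have [delta d0 hd] := density_continuous LF a0 FA (bm_truncate a0 fa.1)
  (truncate_le a0 f) eps0.
exists delta => // B g FB ga fg.
have e1 := densities_ae LF FA fa.1 (bm_truncate a0 fa.1).1 (truncate_ae fa).
have e2 := densities_ae LF FB ga.1 (bm_truncate a0 ga.1).1 (truncate_ae ga).
rewrite e1 e2 -ltcR -normC_normc.
have fg' : dhat (fourier (truncate a f)) (fourier (truncate a g)) < delta.
  by rewrite !fourier_truncate.
exact: hd B _ FB (bm_truncate a0 ga.1) (truncate_le a0 g) fg'.
Qed.
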